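(* Let $n,k$ be positive integers with $k<n$. Let $\tau_n$ be any transposition of $S_n$ and let $\tau_k$ be any transposition of $S_k$. Then the eigenvalues of (the adjacency matrix of) the arrangement graph $A(n,k)$ are exactly the numbers of the form $$\binom{n}{2}\frac{\chi_{\mu}(\tau_n)}{\chi_{\mu}(1)}-\binom{k}{2}\frac{\chi_{\lambda}(\tau_k)}{\chi_{\lambda}(1)}-\binom{n-k}{2},$$ where $\lambda\vdash k$ and where $\mu\vdash n$ is such that $\lambda\prec\mu$.
   Context: For a positive integer $m$ put $I_m=\{1,\dots,m\}$, let $S_m$ be the group of permutations of $I_m$, and for an integer $p$ put $\binom{p}{2}=p(p-1)/2$. Arrangement graph: for $k\le n$, a $k$-permutation is an injective map $\sigma:I_k\to I_n$. The arrangement graph $A(n,k)$ has as vertices all $k$-permutations, two of them being joined by an edge if and only if they agree as functions on exactly $k-1$ elements of $I_k$. Partitions: a partition $\lambda=(\lambda_1,\dots,\lambda_j)$ of $m$ (written $\lambda\vdash m$) is a finite sequence of positive integers with $\lambda_1\ge\cdots\ge\lambda_j$ and $\lambda_1+\cdots+\lambda_j=m$. $S^\lambda$ denotes the irreducible complex representation of $S_m$ corresponding to $\lambda$ (standard labelling by Specht modules, so that $S^{(m)}$ is the trivial representation), and $\chi_\lambda$ denotes its character. For $\lambda\vdash k$ and $\mu\vdash n$, write $\lambda\prec\mu$ if the Young diagram of $\mu$ (rows of lengths $\mu_1\ge\mu_2\ge\cdots$) can be obtained from the Young diagram of $\lambda$ by adding at most one box to each column. *)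

(* Defs.v *)
From mathcomp Require Import all_boot all_order all_algebra all_fingroup.
From mathcomp Require Import all_solvable all_field all_character.

Set Implicit Arguments.
Unset Strict Implicit.
Unset Printing Implicit Defensive.

Import Order.TTheory GRing.Theory Num.Theory.
Local Open Scope ring_scope.

(* Throughout, I_m is the type 'I_m = {0, .., m-1}, and the complex numbers    *)
(* are replaced by algC: adjacency matrices are integral and the Specht        *)
(* modules are defined over the rationals, so no eigenvalue or character       *)
(* value is lost.                                                              *)

Definition kperm (k n : nat) := {f : {ffun 'I_k -> 'I_n} | injectiveb f}.

Definition arrangement_adj (k n : nat) : rel (kperm k n) :=
  fun f g => #|[set i | val f i == val g i]| == (k - 1)%N.

Definition arrangement_mx (n k : nat) : 'M[algC]_#|{: kperm k n}| :=
  \matrix_(i, j) (arrangement_adj (enum_val i) (enum_val j))%:R.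

Definition is_partition (m : nat) (lam : seq nat) : bool :=
  [&& sorted geq lam, all (leq 1) lam & sumn lam == m].

(* Rows and columns are numbered from 0; b.1 is the row, b.2 the column.       *)
Definition in_diagram (lam : seq nat) (b : nat * nat) : bool :=
  (b.2 < nth 0 lam b.1)%N.

Definition prec (lam mu : seq nat) : Prop :=
  (forall b, in_diagram lam b -> in_diagram mu b) /\
  (forall i i' j,
     in_diagram mu (i, j) -> ~~ in_diagram lam (i, j) ->
     in_diagram mu (i', j) -> ~~ in_diagram lam (i', j) -> i = i').

(* The boxes of the diagram of lam |- m are numbered by 'I_m in reading order: *)
(* box b lies in row reshape_index lam b and column reshape_offset lam b. A    *)
(* tableau is then a permutation t : 'S_m, with t b the entry of box b.        *)
Definition row_group (m : nat) (lam : seq nat) : {set 'S_m} :=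
  [set r : 'S_m |
     [forall b, reshape_index lam (r b) == reshape_index lam b]].

Definition col_group (m : nat) (lam : seq nat) : {set 'S_m} :=
  [set c : 'S_m |
     [forall b, reshape_offset lam (c b) == reshape_offset lam b]].

Notation Symg m := [set: 'S_m]%G.

(* In 'S_m, (s * t) i = t (s i), so 'S_m acts on the entries of tableaux by    *)
(* right multiplication, i.e. by the right regular representation. The tabloid *)
(* of t is \sum_r r * t, hence the polytabloid of t is the translate by t of   *)
(* the following Young symmetrizer.                                            *)
Definition young_symmetrizer (m : nat) (lam : seq nat)
    : 'rV[algC]_#|Symg m| :=
  \sum_(r in row_group m lam) \sum_(c in col_group m lam)
    (-1) ^+ c *: delta_mx 0 (gring_index (Symg m) (r * c)%g).

(* The span of all polytabloids, as a submodule of the group algebra.          *)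
Definition specht_mx (m : nat) (lam : seq nat) : 'M[algC]_#|Symg m| :=
  cyclic_mx (regular_repr algC (Symg m)) (young_symmetrizer m lam).

Definition specht_repr (m : nat) (lam : seq nat)
    : mx_representation algC (Symg m) (\rank (specht_mx m lam)) :=
  submod_repr (cyclic_mx_module (regular_repr algC (Symg m))
                                (young_symmetrizer m lam)).

Definition specht_char (m : nat) (lam : seq nat) : 'CF(Symg m) :=
  cfRepr (specht_repr m lam).

Definition is_transposition (m : nat) (s : 'S_m) : Prop :=
  exists i j : 'I_m, i != j /\ s = tperm i j.

(* Main.v *)
Require Import Defs.
From mathcomp Require Import all_boot all_order all_algebra all_fingroup.
From mathcomp Require Import all_solvable all_field all_character.
From mathcomp Require Import zify ring.

Set Implicit Arguments.
Unset Strict Implicit.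
Unset Printing Implicit Defensive.

Import Order.TTheory GRing.Theory Num.Theory.
Local Open Scope ring_scope.

(** The adjacency matrix of A(n, k) is, up to a constant, a difference of sums
    of transpositions.  Lift a function v on the k-permutations to the function
    g |-> v (g^-1 restricted to the first k points) on 'S_n; the image is the
    space of vectors of the regular representation that are fixed by the
    permutations moving only the last n - k points.  Changing one value of a
    k-permutation amounts to composing with a transposition (x y), x < k <= y,
    so the adjacency matrix lifts to the sum of these transpositions
    (lift_adjacency), that is, to half of tperm_sum setT - tperm_sum (first k
    points) - tperm_sum (last n - k points), where tperm_sum D is the sum of
    all (x y) over ordered pairs of points of D (tperm_sum_cross); the last
    term acts on lifted vectors by the scalar (n - k) ^ 2.

    The scalars of the statement are values of these sums.  If a and b are the
    row sum and the alternating column sum of a labelled diagram lam, then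
    a (x y) b is a b, - a b or 0 according as x and y share a row, a column or
    neither (tperm_symmetrizer), so a (tperm_sum D) b = pair_sum lam * a b.
    Hence tperm_sum setT acts on the whole Specht module as the scalar
    pair_sum lam, and taking the trace gives
    pair_sum lam = m + 2 'C(m, 2) chi(tau) / chi(1) (specht_pair_sum).

    Every pair with prec lam mu gives an eigenvalue: label the diagram of
    mu so that the first k points fill lam.  With row and column sums a, b of
    mu, the row sum a' of lam and the sum h of the permutations of the last
    n - k points, the product a b a' h is fixed by the latter permutations,
    and the sums of transpositions act on it by pair_sum mu and pair_sum lam.
    It is nonzero because its coefficient at 1 is a sum of nonnegative terms:
    if r c r' h = 1 then c fixes lam pointwise and permutes the strip mu / lam
    inside its columns, so c = 1, as the strip has at most one box in each
    column (strip_vector_neq0).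

    Conversely, let v be a lifted eigenvector.  The Jucys-Murphy elements jm j,
    the sums of (l j) over l < j, are commuting hermitian matrices, so some
    joint eigenvector u has u v^T <> 0.  The analysis of Okounkov and Vershik
    shows that the eigenvalues of u are the contents of the boxes successively
    added in building a diagram: two consecutive eigenvalues differ, they can
    be exchanged unless they differ by 1, and the pattern x, x +- 1, x does not
    occur (spectrum_contents).  As v is fixed by the adjacent transpositions of
    the last n - k points, exchanging eigenvalues at these points preserves
    u v^T <> 0, and a decrease by 1 between neighbours is impossible
    (occurs_swap).  So u may be chosen with strictly increasing eigenvalues at
    the last n - k points; boxes added with increasing contents lie in
    different columns, which is prec lam mu (increasing_contents_prec), and the
    eigenvalue of v is read off from the sum of the contents. *)

(** * Lattice words and contents *)

(** A word records the successive rows in which boxes are added to a diagram,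
    the most recent box first; [rowlen w i] is then the length of row i of the
    diagram that has been built. *)
Definition rowlen (w : seq nat) (i : nat) : nat := count_mem i w.

Arguments rowlen : simpl never.

Lemma rowlen_cons i w j : rowlen (i :: w) j = ((i == j) + rowlen w j)%N.
Proof. by []. Qed.

Lemma perm_rowlen w w' : perm_eq w w' -> rowlen w =1 rowlen w'.
Proof. by move=> Ew i; apply: (seq.permP Ew). Qed.

Definition addable (w : seq nat) (i : nat) : bool :=
  (i == 0%N) || (rowlen w i < rowlen w i.-1)%N.

(** Lattice words correspond to standard tableaux: every added box must leave
    a Young diagram. *)
Fixpoint lattice (w : seq nat) : bool :=
  if w is i :: w' then lattice w' && addable w' i else true.

Fixpoint word_boxes (w : seq nat) : seq (nat * nat) :=
  if w is i :: w' then (i, rowlen w' i) :: word_boxes w' else [::].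

Definition content (b : nat * nat) : int := b.2%:Z - b.1%:Z.

Definition contents (w : seq nat) : seq int := map content (word_boxes w).

Lemma lattice_rowlen w i : lattice w -> (rowlen w i.+1 <= rowlen w i)%N.
Proof.
elim: w => //= j w IH /andP[/IH le_w]; rewrite /addable !rowlen_cons.
by case: (eqVneq j i.+1) => [->|_] /=; lia.
Qed.

Lemma lattice_rowlen_leq w i j :
  lattice w -> (i <= j)%N -> (rowlen w j <= rowlen w i)%N.
Proof.
move=> Lw; elim: j => [|j IH]; first by case: i.
rewrite leq_eqVlt => /predU1P[-> //|]; rewrite ltnS => /IH.
exact/leq_trans/lattice_rowlen.
Qed.

(** * Content sequences from exchange rules *)

(** [S] stands for the set of joint eigenvalue sequences of the Jucys-Murphy
    elements, the eigenvalue of the last element first; the hypotheses are the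
    exchange rules that these sequences obey. *)
Section Spectrum.

Variables (F : numDomainType) (S : seq F -> Prop).

Let cs (w : seq nat) : seq F := map intr (contents w).

Hypothesis S_first : forall p x, S (rcons p x) -> x = 0.
Hypothesis S_eq : forall p x q, ~ S (p ++ x :: x :: q).
Hypothesis S_swap : forall (p : seq F) (x y : F) (q : seq F),
  x != y + 1 -> y != x + 1 -> S (p ++ y :: x :: q) -> S (p ++ x :: y :: q).
Hypothesis S_braidr : forall p x q, ~ S (p ++ x :: (x + 1) :: x :: q).
Hypothesis S_braidl : forall p x q, ~ S (p ++ (x + 1) :: x :: (x + 1) :: q).

Lemma intr_neqS (a b : int) : a != b + 1 -> (a%:~R : F) != b%:~R + 1.
Proof. by apply: contraNneq => /eqP; rewrite -[1]/(1%:~R) -intrD eqr_int. Qed.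

(** Any corner of the diagram can be made the box added last: it commutes past
    the boxes added after it, because the contents of two different corners
    differ by at least 2, so that the exchange rule applies. *)
Lemma spectrum_corner_last p w i :
    lattice w -> (rowlen w i.+1 < rowlen w i)%N -> S (p ++ cs w) ->
  exists w', [/\ lattice (i :: w'), perm_eq w (i :: w')
               & S (p ++ cs (i :: w'))].
Proof.
elim: w p => [|j w IH] p // Ljw lt_i Sw; move: (Ljw) => /= /andP[Lw Aj].
have le_j := lattice_rowlen j Lw.
case: (eqVneq j i) => [Eji | neq_ji]; first by exists w; rewrite -Eji.
rewrite !rowlen_cons (negPf neq_ji) add0n in lt_i.
have lt_i' : (rowlen w i.+1 < rowlen w i)%N by lia.
have [|w1 [Liw1 Ew1 Sw1]] :=
    IH (rcons p (content (j, rowlen w j))%:~R) Lw lt_i'.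
  by rewrite cat_rcons.
move: (Liw1) => /= /andP[Lw1 Ai]; have cnt := perm_rowlen Ew1.
have cj := cnt j; have ci := cnt i; have ci1 := cnt i.+1; have cj1 := cnt j.-1.
rewrite !rowlen_cons in cj ci ci1 cj1.
rewrite eq_sym (negPf neq_ji) add0n in cj; rewrite eqxx add1n in ci.
rewrite (ltn_eqF (ltnSn i)) add0n in ci1.
have Lj : lattice (j :: w1).
  rewrite /= Lw1 /=; move: Aj; rewrite /addable.
  case: (eqVneq j 0%N) => //= j_n0.
  case: (eqVneq i j.-1) => [Eij|_] in cj1 *; last by lia.
  have Ej : j = i.+1 by lia.
  by rewrite -Eij {}Ej eqxx in cj1 lt_i cj *; lia.
have {cj1} Li : addable (j :: w1) i.
  by move: Ai; rewrite /addable !rowlen_cons (negPf neq_ji); lia.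
exists (j :: w1); split.
- by rewrite /= Li; move: Lj => /= ->.
- apply: (@perm_trans _ [:: j, i & w1]); first by rewrite perm_cons.
  by rewrite (perm_catCA [:: j] [:: i] w1).
(* i and j are corners of the diagram of j :: w. *)
have far : 2 <= `|content (j, rowlen w j) - content (i, rowlen w1 i)|.
  rewrite /content /=; clear Lj Li Liw1 Lw1 Ew1 Sw1 Ai; have [lt_ij|ge_ij] := ltnP i j.
    by have := lattice_rowlen_leq Ljw lt_ij; rewrite !rowlen_cons; lia.
  have lt_ji : (j < i)%N by rewrite ltn_neqAle neq_ji.
  by have := lattice_rowlen_leq Lw lt_ji; lia.
rewrite cat_rcons in Sw1; rewrite /cs /contents /= rowlen_cons.
rewrite (negPf neq_ji) add0n -cj.
by apply: S_swap Sw1; apply: intr_neqS; clear -far; lia.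
Qed.

(** The next eigenvalue x must be the content of an addable box.  Compare x with
    the content c of the last box.  If they are far apart, exchange them and use
    induction.  If x = c + 1 and the box to the right of the last one is not
    addable, then the box above the last one can be moved just before it, and
    the pattern x, c, x appears.  If x = c - 1, argue likewise with the box below
    the last one and the box on its left. *)
Lemma spectrum_step p x w :
    lattice w -> S (p ++ x :: cs w) ->
  exists2 i, addable w i & x = (content (i, rowlen w i))%:~R.
Proof.
move: {2}(size w) (erefl (size w)) => m.
elim: m p w => [|m IH] p [|i w] // Ew.
  move=> _ Sx; exists 0%N => //; rewrite /content subrr.
  by apply: (S_first (p := p)); rewrite -cats1.
case: Ew => Ew /andP[Lw Ai]; rewrite /cs /contents /= -/(contents w) -/(cs w).
set c := content _ => Sw.
have [Ex|neq_xc] := eqVneq x c%:~R.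
  by case: (S_eq (p := p) (x := x) (q := cs w)); rewrite {2}Ex.
have le_i := lattice_rowlen i Lw.
have [Ex|neq_x1] := eqVneq x (c + 1)%:~R.
  rewrite {}Ex {neq_xc} in Sw *.
  (* The box to the right of the last one has content c + 1. *)
  case Aii: (addable (i :: w) i).
    by exists i => //; rewrite rowlen_cons /c /content /=; congr (_%:~R); lia.
  case: i Ai => [|i] //= Ai in c le_i Sw Aii *.
  have lt_i : (rowlen w i.+1 < rowlen w i)%N by move: Ai; rewrite /addable.
  have cnt_i : rowlen w i = (rowlen w i.+1).+1.
    by move: Aii; rewrite /addable !rowlen_cons /=; lia.
  have [|w1 [_ Ew1]] := spectrum_corner_last
      (p := rcons (rcons p (c + 1)%:~R) c%:~R) Lw lt_i; first by rewrite !cat_rcons.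
  rewrite /cs /contents /= !cat_rcons.
  rewrite (_ : content (i, rowlen w1 i) = c + 1) ?intrD => [/S_braidl //|].
  by have := perm_rowlen Ew1 i; rewrite rowlen_cons /c /content /=; lia.
have [Ex|neq_x2] := eqVneq x (c - 1)%:~R.
  rewrite {}Ex in Sw *.
  (* Below the last box, the content is c - 1. *)
  case: (eqVneq (rowlen w i.+1) (rowlen w i)) => [Ei|neq_i].
    exists i.+1; first by rewrite /addable !rowlen_cons /=; lia.
    by rewrite rowlen_cons /c /content /=; congr (_%:~R); lia.
  have lt_i : (rowlen w i.+1 < rowlen w i)%N by rewrite ltn_neqAle neq_i.
  have [|w1 [_ Ew1]] := spectrum_corner_last
      (p := rcons (rcons p (c - 1)%:~R) c%:~R) Lw lt_i; first by rewrite !cat_rcons.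
  rewrite /cs /contents /= !cat_rcons.
  rewrite (_ : content (i, rowlen w1 i) = c - 1); last first.
    by have := perm_rowlen Ew1 i; rewrite rowlen_cons /c /content /=; lia.
  have -> : c%:~R = (c - 1)%:~R + 1 :> F by rewrite -[1]/(1%:~R) -intrD subrK.
  by move/S_braidr.
have {}Sw : S (rcons p c%:~R ++ x :: cs w).
  rewrite cat_rcons; apply: S_swap Sw; last by rewrite intrD in neq_x1.
  by apply: contraNneq neq_x2; rewrite intrD => ->; rewrite -addrA subrr addr0.
have [j Aj Ex] := IH _ _ Ew Lw Sw.
have neq_ij : i != j by apply: contraNneq neq_xc => Eij; rewrite Ex /c Eij.
exists j; last by rewrite rowlen_cons (negPf neq_ij).
by move: Aj; rewrite /addable !rowlen_cons; lia.
Qed.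

Lemma spectrum_contents s : S s -> exists2 w, lattice w & s = cs w.
Proof.
suff H p q : S (p ++ q) -> exists2 w, lattice w & q = cs w by exact: (H [::]).
elim: q p => [|x q IH] p Sq; first by exists [::].
rewrite -cat_rcons in Sq; have [w Lw Eq] := IH _ Sq.
rewrite cat_rcons Eq in Sq; have [i Ai ->] := spectrum_step Lw Sq.
by exists (i :: w); rewrite /= ?Lw // Eq.
Qed.

End Spectrum.

(** * Boxes of a diagram *)

Definition boxes (lam : seq nat) : seq (nat * nat) :=
  flatten [seq [seq (i, j) | j <- iota 0 (nth 0%N lam i)] | i <- iota 0 (size lam)].

Lemma mem_boxes lam b : (b \in boxes lam) = in_diagram lam b.
Proof.
case: b => i j; apply/flatten_mapP/idP => [[i' i'_in /mapP[j' j'_in [-> ->]]]|].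
  by move: j'_in; rewrite mem_iota.
rewrite /in_diagram /= => lt_j; exists i; last by rewrite map_f // mem_iota.
rewrite mem_iota /= add0n ltnNge; apply: contraL lt_j => le_i.
by rewrite nth_default.
Qed.

Lemma shape_boxes lam :
  shape [seq [seq (i, j) | j <- iota 0 (nth 0%N lam i)] | i <- iota 0 (size lam)]
  = lam.
Proof.
rewrite /shape -map_comp -[RHS](mkseq_nth 0%N) /mkseq; apply: eq_map => i /=.
by rewrite size_map size_iota.
Qed.

Lemma size_boxes lam : size (boxes lam) = sumn lam.
Proof. by rewrite size_flatten shape_boxes. Qed.

Lemma nth_boxes lam x : (x < sumn lam)%N ->
  nth (0%N, 0%N) (boxes lam) x = (reshape_index lam x, reshape_offset lam x).
Proof.
move=> lt_x; rewrite nth_flatten shape_boxes.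
rewrite (nth_map 0%N) ?size_iota ?reshape_indexP //.
rewrite nth_iota ?reshape_indexP // add0n.
by rewrite (nth_map 0%N) ?size_iota ?nth_iota ?reshape_offsetP.
Qed.

Lemma uniq_boxes lam : uniq (boxes lam).
Proof.
apply/(uniqP (0%N, 0%N)) => x y; rewrite !inE size_boxes => lt_x lt_y.
rewrite !nth_boxes // => -[Er Ec].
by rewrite -(reshape_indexK lam x) Er Ec reshape_indexK.
Qed.

Lemma partition_leq m lam i j :
  is_partition m lam -> (i <= j)%N -> (nth 0%N lam j <= nth 0%N lam i)%N.
Proof.
case/and3P=> s_lam _ _ le_ij; have [lt_j|ge_j] := ltnP j (size lam); last first.
  by rewrite nth_default.
have geq_trans : transitive geq by move=> x y z; lia.
apply: (sorted_leq_nth geq_trans _ 0%N s_lam) => //.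
  by move=> x; apply: leqnn.
exact: (leq_ltn_trans le_ij lt_j).
Qed.

(** * The diagram of a lattice word *)

Definition word_shape (w : seq nat) : seq nat :=
  foldr (fun i lam => incr_nth lam i) [::] w.

Lemma nth_word_shape w i : nth 0%N (word_shape w) i = rowlen w i.
Proof.
by elim: w => [|j w IH] /=; [case: i | rewrite nth_incr_nth IH].
Qed.

Lemma word_shape_partition w : lattice w -> is_partition (size w) (word_shape w).
Proof.
move=> Lw; apply/and3P; split.
- apply/(sortedP 0%N) => i _; rewrite !nth_word_shape.
  exact: lattice_rowlen.
- elim: w Lw => //= i w IH /andP[Lw Ai]; have {IH} pos_w := IH Lw.
  apply/(all_nthP 0%N) => j; rewrite nth_incr_nth size_incr_nth.
  case: (eqVneq i j) => //= neq_ij.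
  case: ifP => [_|le_i]; first exact: (all_nthP 0%N pos_w).
  rewrite ltnS leq_eqVlt eq_sym (negPf neq_ij) /= => lt_ji; clear neq_ij.
  move: Ai; rewrite /addable -!nth_word_shape; case: i => [|i] //= in le_i lt_ji *.
  move=> lt_w; rewrite ltnS in lt_ji.
  have lt_iw : (i < size (word_shape w))%N.
    by rewrite ltnNge; apply: contraL lt_w => ?; rewrite [X in (_ < X)%N]nth_default.
  exact: (all_nthP 0%N pos_w _ (leq_ltn_trans lt_ji lt_iw)).
- elim: w {Lw} => //= i w /eqP IH; rewrite -[X in _ == X.+1]IH.
  move: (word_shape w) => s; elim: s i => [|x s IHs] [|i] //=.
    by elim: i => //= i /eqP ->.
  by rewrite (eqP (IHs i)) addnS.
Qed.

Lemma mem_strip p q i j :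
  ((i, j) \in take (size p) (word_boxes (p ++ q)))
  = (rowlen q i <= j < rowlen (p ++ q) i)%N.
Proof.
elim: p => [|a p IH] /=; first by rewrite take0 in_nil; lia.
rewrite inE {}IH rowlen_cons xpair_eqE.
have le_q : (rowlen q i <= rowlen (p ++ q) i)%N.
  by rewrite /rowlen count_cat leq_addl.
rewrite [a == i]eq_sym; case: (eqVneq i a) => [<-|_] /=; lia.
Qed.

Lemma mem_word_boxes w b : (b \in word_boxes w) = (b.2 < rowlen w b.1)%N.
Proof.
have sz_w : size (word_boxes w) = size w by elim: w => //= i w ->.
case: b => i j; have := mem_strip w [::] i j; rewrite cats0 -sz_w take_size => ->.
by [].
Qed.

Lemma perm_word_boxes w : perm_eq (word_boxes w) (boxes (word_shape w)).
Proof.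
apply: uniq_perm (uniq_boxes _) _ => [|b]; last first.
  by rewrite mem_word_boxes mem_boxes /in_diagram nth_word_shape.
elim: w => //= i w ->; by rewrite mem_word_boxes /= ltnn.
Qed.

(** If the box added at row i + 1 lay below a box of the strip, that box would
    have content larger by 1 than the last one, which is supposed to have the
    largest content of the strip. *)
Lemma horizontal_strip_leq p q i :
    lattice (p ++ q) ->
    sorted (fun a b : int => b < a) (take (size p) (contents (p ++ q))) ->
  (rowlen (p ++ q) i.+1 <= rowlen q i)%N.
Proof.
elim: p => [|a p IH] /=; first by move=> /lattice_rowlen.
move=> /andP[Lw Aa] c_path; have {IH} IH := IH Lw (path_sorted c_path).
rewrite rowlen_cons; case: (eqVneq a i.+1) => [Ea|//]; rewrite {a}Ea in Aa c_path *.
rewrite add1n ltnNge; apply/negP => le_q.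
have lt_w : (rowlen (p ++ q) i.+1 < rowlen (p ++ q) i)%N by move: Aa; rewrite /addable.
have gt_trans : transitive (fun a b : int => b < a).
  by move=> x y z lt_xy lt_yz; apply: lt_trans lt_yz lt_xy.
have /allP/(_ (content (i, rowlen (p ++ q) i.+1))) := order_path_min gt_trans c_path.
rewrite /contents -map_take map_f; last by rewrite mem_strip le_q.
by move/(_ isT); rewrite /content /=; lia.
Qed.

Lemma increasing_contents_prec p q :
    lattice (p ++ q) ->
    sorted (fun a b : int => b < a) (take (size p) (contents (p ++ q))) ->
  prec (word_shape q) (word_shape (p ++ q)).
Proof.
move=> Lw c_sort; have strip i := horizontal_strip_leq i Lw c_sort.
have le_q i : (rowlen q i <= rowlen (p ++ q) i)%N.
  by rewrite /rowlen count_cat leq_addl.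
split=> [[i j]|i i' j]; rewrite /in_diagram !nth_word_shape /=.
  by move/leq_trans; apply.
rewrite -!leqNgt => lt_i ge_i lt_i' ge_i'; case: (ltngtP i i') => // lt_ii'.
  have := lattice_rowlen_leq Lw lt_ii'; have := strip i; lia.
have := lattice_rowlen_leq Lw lt_ii'; have := strip i'; lia.
Qed.

(** * Labelled diagrams *)

Section Labelling.

Variables (T : finType).

(** A tableau in the form used below: [pos] places the points of [D] bijectively
    in the boxes of [lam].  Taking for [D] the first k points of 'I_n lets one
    labelling of mu contain a labelling of lam. *)
Definition labelling (D : {set T}) (pos : T -> nat * nat) (lam : seq nat) : bool :=
  perm_eq [seq pos x | x in D] (boxes lam).

Variables (D : {set T}) (pos : T -> nat * nat) (lam : seq nat).
Hypothesis lab : labelling D pos lam.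

Lemma labelling_inj : {in D &, injective pos}.
Proof.
have : uniq [seq pos x | x in D] by rewrite (perm_uniq lab) uniq_boxes.
by move/dinjectiveP.
Qed.

Lemma labelling_mem x : x \in D -> in_diagram lam (pos x).
Proof. by move=> Dx; rewrite -mem_boxes -(perm_mem lab) image_f. Qed.

Lemma labelling_onto b : in_diagram lam b -> exists2 x, x \in D & pos x = b.
Proof.
rewrite -mem_boxes -(perm_mem lab) => /imageP[x Dx ->]; by exists x.
Qed.

Lemma labelling_sum (V : nmodType) (F : nat * nat -> V) :
  \sum_(x in D) F (pos x) = \sum_(b <- boxes lam) F b.
Proof. by rewrite -(perm_big _ lab) big_map big_enum. Qed.

End Labelling.

Lemma labelling_nth (n k : nat) (bs : seq (nat * nat)) lam :
    size bs = n -> uniq bs -> (k <= n)%N -> perm_eq (take k bs) (boxes lam) ->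
  labelling [set x : 'I_n | (x < k)%N] (fun x => nth (0%N, 0%N) bs x) lam.
Proof.
move=> sz_bs u_bs le_kn E; apply: perm_trans E.
apply: uniq_perm (take_uniq _ u_bs) _ => [|b].
  rewrite /image_mem map_inj_in_uniq ?enum_uniq // => x y _ _ /eqP.
  by rewrite nth_uniq ?sz_bs // => /eqP/val_inj.
have sz_t : size (take k bs) = k by rewrite size_takel ?sz_bs.
apply/imageP/idP => [[x /[!inE] lt_x ->]|/(nthP (0%N, 0%N))[i]].
  by rewrite -(nth_take _ lt_x) mem_nth ?sz_t.
rewrite sz_t => lt_i <-; have lt_in := leq_trans lt_i le_kn.
by exists (Ordinal lt_in); rewrite ?inE //= nth_take.
Qed.

Lemma reading_labelling m lam : sumn lam = m ->
  labelling [set: 'I_m] (fun x => (reshape_index lam x, reshape_offset lam x)) lam.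
Proof.
move=> Em; have Es : size (boxes lam) = m by rewrite size_boxes.
have := @labelling_nth m m _ lam Es (uniq_boxes _) (leqnn m).
rewrite -{1}Es take_size => /(_ (perm_refl _)); rewrite /labelling.
congr perm_eq; rewrite /image_mem (_ : enum _ = enum [set: 'I_m]).
  by apply: eq_map => x; rewrite nth_boxes // Em.
by apply: eq_enum => x; rewrite !inE ltn_ord.
Qed.

(** Number the boxes of lam first, then those of the strip. *)
Lemma prec_labelling n k lam mu :
    (k <= n)%N -> sumn lam = k -> sumn mu = n -> prec lam mu ->
  exists2 pos, labelling [set: 'I_n] pos mu
             & labelling [set x : 'I_n | (x < k)%N] pos lam.
Proof.
move=> le_kn Ek En [sub_lm _].
pose bs := boxes lam ++ [seq b <- boxes mu | b \notin boxes lam].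
have u_bs : uniq bs.
  rewrite cat_uniq uniq_boxes filter_uniq ?uniq_boxes // andbT.
  by apply/hasPn => b; rewrite mem_filter => /andP[].
have E : perm_eq bs (boxes mu).
  apply: uniq_perm (uniq_boxes _) _ => // b.
  rewrite mem_cat mem_filter; case: (boolP (b \in boxes lam)) => //=.
  by rewrite !mem_boxes => /sub_lm ->.
have sz : size bs = n by rewrite (perm_size E) size_boxes.
exists (fun x : 'I_n => nth (0%N, 0%N) bs x); last first.
  by apply: labelling_nth => //; rewrite /bs take_size_cat // size_boxes.
have -> : [set: 'I_n] = [set x : 'I_n | (x < n)%N].
  by apply/setP => x; rewrite !inE ltn_ord.
by apply: labelling_nth => //; rewrite -sz take_size.
Qed.

(** * The action of transpositions in terms of boxes *)

(** The scalar by which [tperm_sum] acts: a pair of points in the same row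
    contributes 1, in the same column - 1, and the diagonal terms, for which
    tperm x x = 1, contribute 1.  Since it depends on the boxes only, labellings
    of the same diagram have the same scalar. *)
Definition pair_sum (lam : seq nat) : algC :=
  \sum_(b <- boxes lam) \sum_(c <- boxes lam)
    ((b.1 == c.1)%:R - (b.2 == c.2)%:R + (b == c)%:R).

Lemma count_row_word w i :
  count (fun b => b.1 == i) (word_boxes w) = rowlen w i.
Proof. by elim: w => //= j w ->; rewrite rowlen_cons. Qed.

(** Conjugate diagrams: box (i, j) is present iff i is less than the length of
    column j. *)
Lemma ltn_count_col w i j : lattice w ->
  (i < count (fun b => b.2 == j) (word_boxes w))%N = (j < rowlen w i)%N.
Proof.
elim: w i => [|a w IH] i //= /andP[Lw Aa]; rewrite rowlen_cons.
have {}IH i' := IH i' Lw; move: (count _ _) IH => c IH.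
have [Ej|neq_j] := eqVneq (rowlen w a) j; last first.
  by rewrite add0n IH; case: (eqVneq a i) => [<-|_] //; lia.
have Ec : c = a.
  apply/eqP; rewrite eqn_leq leqNgt IH Ej ltnn /=.
  by case: a Aa Ej => // a; rewrite /addable /= IH => Aa <-.
have := IH i; rewrite Ec add1n ltnS.
by case: (eqVneq a i) => [<-|]; lia.
Qed.

Lemma count_col_addable w i : lattice w -> addable w i ->
  count (fun b => b.2 == rowlen w i) (word_boxes w) = i.
Proof.
move=> Lw Ai; apply/eqP; rewrite eqn_leq leqNgt ltn_count_col // ltnn /=.
by case: i Ai => // i; rewrite /addable /= ltn_count_col.
Qed.

(** Adding a box in row i and column j creates j pairs in a row and i pairs in a
    column, each counted in both orders, and one diagonal term: the sum grows by
    twice the content plus 1. *)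
Lemma pair_sum_word w : lattice w ->
  pair_sum (word_shape w) = (\sum_(a <- contents w) a%:~R) *+ 2 + (size w)%:R.
Proof.
rewrite /pair_sum => Lw.
pose f (b c : nat * nat) : algC := (b.1 == c.1)%:R - (b.2 == c.2)%:R + (b == c)%:R.
rewrite -(perm_big _ (perm_word_boxes w)) /=.
transitivity (\sum_(b <- word_boxes w) \sum_(c <- word_boxes w) f b c).
  by apply: eq_bigr => b _; rewrite -(perm_big _ (perm_word_boxes w)).
elim: w Lw => [|i w IH] /=; first by rewrite /contents /= !big_nil mul0rn addr0.
move=> /andP[Lw Ai]; rewrite /contents /= big_cons -/(contents w).
set b0 := (i, rowlen w i).
have b0_notin : b0 \notin word_boxes w by rewrite mem_word_boxes /= ltnn.
transitivity (f b0 b0 + \sum_(c <- word_boxes w) f b0 c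
    + \sum_(b <- word_boxes w) (f b b0 + \sum_(c <- word_boxes w) f b c)).
  by rewrite !big_cons; congr (_ + _); apply: eq_bigr => b _; rewrite big_cons.
rewrite [X in _ + X = _]big_split /= {}IH // {1}/f !eqxx subrr add0r [in RHS]big_cons.
have cnt (P : pred (nat * nat)) :
    \sum_(b <- word_boxes w) (P b)%:R = (count P (word_boxes w))%:R :> algC.
  by elim: (word_boxes w) => [|b s IHs]; rewrite ?big_nil //= big_cons natrD IHs.
have E : \sum_(b <- word_boxes w) f b0 b = (content b0)%:~R.
  have c0 : count (fun b => b0 == b) (word_boxes w) = 0%N.
    by rewrite -(count_memPn b0_notin); apply: eq_count => b; rewrite /= eq_sym.
  have c1 : count (fun b => i == b.1) (word_boxes w) = rowlen w i.
    by rewrite -count_row_word; apply: eq_count => b; rewrite eq_sym.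
  have c2 : count (fun b => rowlen w i == b.2) (word_boxes w) = i.
    by rewrite -[RHS](count_col_addable Lw Ai); apply: eq_count => b; rewrite eq_sym.
  by rewrite big_split sumrB /= !cnt c0 c1 c2 addr0 /content intrB.
rewrite E (eq_bigr (f b0)) ?E => [|b _].
  by rewrite -[(size w).+1]addn1 natrD (_ : true%:R = 1) //; ring.
by rewrite /f ![_ == b.1]eq_sym ![_ == b.2]eq_sym [_ == b]eq_sym.
Qed.

(** * Row and column sums *)

Section Symmetrizers.

Variables (n N : nat) (rG : mx_representation algC (Symg n) N).

Lemma sym_reprM g h : rG (g * h)%g = rG g *m rG h.
Proof. by rewrite repr_mxM ?inE. Qed.

(** Summing over all ordered pairs, including the diagonal, makes the
    conjugation invariance a plain reindexing.  This is twice the sum of the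
    transpositions of [D], plus #|D|. *)
Definition tperm_sum (D : {set 'I_n}) : 'M[algC]_N :=
  \sum_(x in D) \sum_(y in D) rG (tperm x y).

Lemma tperm_sum_comm (D : {set 'I_n}) (g : 'S_n) :
    (forall x, (g x \in D) = (x \in D)) ->
  rG g *m tperm_sum D = tperm_sum D *m rG g.
Proof.
move=> gD; rewrite /tperm_sum mulmx_sumr mulmx_suml.
rewrite (reindex_inj (@perm_inj _ g)); apply: eq_big => [x|x _]; first exact: gD.
rewrite mulmx_sumr mulmx_suml.
rewrite (reindex_inj (@perm_inj _ g)); apply: eq_big => [y|y _]; first exact: gD.
by rewrite -!sym_reprM -tpermJ conjgE !mulgA mulgV mul1g.
Qed.

Definition stab (D : {set 'I_n}) (f : 'I_n -> nat) : {set 'S_n} :=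
  [set r : 'S_n | perm_on D r & [forall x, f (r x) == f x]].

Lemma stabP D f r :
  reflect (perm_on D r /\ forall x, f (r x) = f x) (r \in stab D f).
Proof.
rewrite inE; apply: (iffP andP) => [[-> /eqfunP]|[-> /eqfunP]] //.
Qed.

Lemma stab_group_set D f : group_set (stab D f).
Proof.
apply/group_setP; split=> [|r s /stabP[Dr fr] /stabP[Ds fs]].
  by apply/stabP; split=> [|x]; rewrite ?perm_on1 ?perm1.
by apply/stabP; split=> [|x]; rewrite ?perm_onM // permM fs fr.
Qed.

Canonical stab_group D f := Group (stab_group_set D f).

Lemma stab_tperm (D : {set 'I_n}) f x y :
  x \in D -> y \in D -> f x = f y -> tperm x y \in stab D f.
Proof.
move=> Dx Dy Ef; apply/stabP; split=> [|z]; last by case: tpermP => // ->.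
apply: (subset_trans (tperm_on x y)); apply/subsetP=> z; rewrite !inE.
by case/orP=> /eqP->.
Qed.

Definition stab_sum (D : {set 'I_n}) f : 'M[algC]_N := \sum_(r in stab D f) rG r.

Definition alt_stab_sum (D : {set 'I_n}) f : 'M[algC]_N :=
  \sum_(c in stab D f) (-1) ^+ c *: rG c.

Lemma stab_sumM D f r : r \in stab D f -> stab_sum D f *m rG r = stab_sum D f.
Proof.
move=> Rr; rewrite mulmx_suml [RHS](reindex_inj (mulIg r)).
by apply: eq_big => [s|s _]; rewrite ?sym_reprM // groupMr.
Qed.

Lemma mul_alt_stab_sum D f c : c \in stab D f ->
  rG c *m alt_stab_sum D f = (-1) ^+ c *: alt_stab_sum D f.
Proof.
move=> Cc; rewrite mulmx_sumr [in RHS]/alt_stab_sum (reindex_inj (mulgI c^-1%g)).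
rewrite scaler_sumr; apply: eq_big => [s|s _]; first by rewrite groupMl ?groupV.
rewrite -scalemxAr -sym_reprM mulKVg scalerA odd_permM odd_permV; congr (_ *: _).
by rewrite signr_addb mulrC.
Qed.

Section Eigenvalue.

Variables (D : {set 'I_n}) (pos : 'I_n -> nat * nat) (m : nat) (lam : seq nat).
Hypotheses (lam_part : is_partition m lam) (lab : labelling D pos lam).

Let rowf x := (pos x).1.
Let colf x := (pos x).2.

(** If x and y share neither a row nor a column, let x be in the upper row; the
    box z in the row of x and the column of y lies in the diagram.  Then
    (x z)(x y) = (x y)(y z), where (x z) is absorbed by the row sum and (y z)
    changes the sign of the column sum, so the product equals its opposite. *)
Lemma tperm_symmetrizer x y : x \in D -> y \in D ->
  stab_sum D rowf *m rG (tperm x y) *m alt_stab_sum D colf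
  = ((rowf x == rowf y)%:R - (colf x == colf y)%:R + (x == y)%:R)
    *: (stab_sum D rowf *m alt_stab_sum D colf).
Proof.
move=> Dx Dy; have [<-|neq_xy] := eqVneq x y.
  by rewrite tperm1 repr_mx1 mulmx1 !eqxx subrr add0r scale1r.
rewrite addr0; have [Er|neq_r] := eqVneq (rowf x) (rowf y).
  have -> : (colf x == colf y) = false.
    apply: contraNF neq_xy => /eqP Ec; apply/eqP/(labelling_inj lab Dx Dy).
    by rewrite [LHS]surjective_pairing [RHS]surjective_pairing; congr pair.
  by rewrite stab_sumM ?stab_tperm // subr0 scale1r.
have [Ec|neq_c] := eqVneq (colf x) (colf y).
  rewrite -mulmxA mul_alt_stab_sum ?stab_tperm // odd_tperm neq_xy.
  by rewrite sub0r -scalemxAr.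
wlog lt_r : x y Dx Dy neq_xy neq_r neq_c / (rowf x < rowf y)%N.
  move=> H; have [lt_xy|lt_yx|] := ltngtP (rowf x) (rowf y); first exact: H.
    by rewrite tpermC; apply: H => //; rewrite eq_sym.
  by move=> /eqP; rewrite (negPf neq_r).
rewrite sub0r oppr0 scale0r.
have [z Dz Ez] : exists2 z, z \in D & pos z = (rowf x, colf y).
  apply: (labelling_onto lab); rewrite /in_diagram /=.
  have := labelling_mem lab Dy; rewrite /in_diagram => /leq_trans; apply.
  exact: (partition_leq lam_part (ltnW lt_r)).
have neq_zx : z != x.
  by apply: contraNneq neq_c => <-; rewrite /colf Ez.
have neq_zy : z != y by apply: contraNneq neq_r => <-; rewrite /rowf Ez.
have Rq : tperm x z \in stab D rowf by rewrite stab_tperm // /rowf Ez.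
have Cq : tperm y z \in stab D colf by rewrite stab_tperm // /colf Ez.
have Eq : (tperm x z * tperm x y = tperm x y * tperm y z)%g.
  have := tpermJ x z (tperm x y); rewrite tpermL tpermD 1?eq_sym // => <-.
  exact: conjgC.
(* A vector equal to its opposite vanishes in characteristic 0. *)
have neg : stab_sum D rowf *m rG (tperm x y) *m alt_stab_sum D colf
    = - (stab_sum D rowf *m rG (tperm x y) *m alt_stab_sum D colf).
  rewrite -{1}(stab_sumM Rq) -mulmxA -(mulmxA (stab_sum _ _)) (mulmxA (rG _)) -sym_reprM Eq sym_reprM.
  rewrite -!mulmxA mul_alt_stab_sum // odd_tperm eq_sym neq_zy expr1 scaleN1r.
  by rewrite !mulmxN.
apply/eqP; move/eqP: neg; rewrite -addr_eq0 -mulr2n -scaler_nat scaler_eq0.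
by rewrite pnatr_eq0.
Qed.

Lemma tperm_sum_symmetrizer :
  stab_sum D rowf *m tperm_sum D *m alt_stab_sum D colf
  = pair_sum lam *: (stab_sum D rowf *m alt_stab_sum D colf).
Proof.
move: (stab_sum D rowf) (alt_stab_sum D colf) tperm_symmetrizer => a b ab.
rewrite /pair_sum /tperm_sum -(labelling_sum lab) scaler_suml mulmx_sumr mulmx_suml.
apply: eq_bigr => x Dx; rewrite -(labelling_sum lab) scaler_suml.
rewrite mulmx_sumr mulmx_suml; apply: eq_bigr => y Dy.
rewrite ab //; congr ((_ + (nat_of_bool _)%:R) *: _).
apply/eqP/eqP => [-> //|]; exact: (labelling_inj lab).
Qed.

End Eigenvalue.

End Symmetrizers.

(** * A nonzero vector attached to a horizontal strip *)

Section RegularRepresentation.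

Variable n : nat.

Local Notation aG := (regular_repr algC (Symg n)).
Local Notation N := #|Symg n|.

Lemma regular_reprE (g : 'S_n) (i j : 'I_N) :
  aG g i j = (enum_val j == enum_val i * g)%g%:R.
Proof.
rewrite !mxE eqxx /= -[j in LHS](@gring_valK _ (Symg n)).
by rewrite (can_in_eq (@gring_indexK _ (Symg n))) ?inE.
Qed.

(** Transposition is the matrix form of the inversion g |-> g^-1 of the group
    algebra; it exchanges the two orders in which row and column sums are
    multiplied. *)
Lemma tr_regular_repr (g : 'S_n) : (aG g)^T = aG g^-1%g.
Proof.
apply/matrixP=> i j; rewrite mxE !regular_reprE; congr (nat_of_bool _)%:R.
by apply/eqP/eqP => ->; rewrite ?mulgK ?mulgKV.
Qed.

Lemma tr_tperm_sum D : (tperm_sum aG D)^T = tperm_sum aG D.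
Proof.
rewrite /tperm_sum !raddf_sum; apply: eq_bigr => x _.
by rewrite raddf_sum; apply: eq_bigr => y _; rewrite /= tr_regular_repr tpermV.
Qed.

Lemma tr_stab_sum D f : (stab_sum aG D f)^T = stab_sum aG D f.
Proof.
rewrite /stab_sum raddf_sum [RHS](reindex_inj invg_inj).
by apply: eq_big => r => [|_]; rewrite ?groupV //= tr_regular_repr.
Qed.

Lemma tr_alt_stab_sum D f : (alt_stab_sum aG D f)^T = alt_stab_sum aG D f.
Proof.
rewrite /alt_stab_sum raddf_sum [RHS](reindex_inj invg_inj).
apply: eq_big => r => [|_]; rewrite ?groupV //=.
by rewrite linearZ /= tr_regular_repr odd_permV.
Qed.

Lemma delta_regular (g h : 'S_n) :
  delta_mx 0 (gring_index (Symg n) g) *m aG h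
  = delta_mx 0 (gring_index (Symg n) (g * h)) :> 'rV_N.
Proof. by rewrite -rowE rowK gring_indexK ?inE. Qed.

Lemma mul_stab_sumE (u : 'rV_N) D f :
  u *m stab_sum aG D f = \sum_(r in stab D f) u *m aG r.
Proof. exact: mulmx_sumr. Qed.

Lemma mul_alt_stab_sumE (u : 'rV_N) D f :
  u *m alt_stab_sum aG D f = \sum_(c in stab D f) (-1) ^+ c *: (u *m aG c).
Proof. by rewrite mulmx_sumr; apply: eq_bigr => c _; rewrite -scalemxAr. Qed.

Section StripVector.

Variables (D : {set 'I_n}) (pos : 'I_n -> nat * nat).
Hypothesis pos_inj : injective pos.
Hypothesis col_inj : {in ~: D &, injective (fun x => (pos x).2)}.

Let rowf x := (pos x).1.
Let colf x := (pos x).2.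

(** The Young symmetrizer of mu, multiplied by the row sum of lam, which brings it
    into an eigenspace of [tperm_sum D], and made invariant under the
    permutations of the complement of [D]. *)
Definition strip_vector : 'rV[algC]_N :=
  delta_mx 0 (gring_index (Symg n) 1%g)
  *m stab_sum aG setT rowf *m alt_stab_sum aG setT colf
  *m stab_sum aG D rowf *m stab_sum aG (~: D) (fun=> 0%N).

(** c^-1 = r' h r preserves rows on [D] and columns everywhere, so it fixes [D]
    pointwise; it then permutes the complement inside the columns, each of which
    meets the complement at most once. *)
Lemma strip_col_trivial r c r' h :
    r \in stab setT rowf -> c \in stab setT colf -> r' \in stab D rowf ->
    h \in stab (~: D) (fun=> 0%N) -> (r * c * r' * h = 1)%g ->
  c = 1%g.
Proof.
move=> /stabP[_ Rr] Cc /stabP[Dr' Rr'] /stabP[Dh _] E.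
have {E} Ec : c^-1%g = (r' * h * r)%g.
  apply: (mulgI c); rewrite mulgV; apply: (mulgI r); apply: (mulIg r^-1%g).
  by rewrite mulg1 mulgV -!mulgA mulgV mulg1 !mulgA E.
have /stabP[_ Cc'] : c^-1%g \in stab setT colf by rewrite groupV.
have fixD x : x \in D -> (c^-1)%g x = x.
  move=> Dx; apply: pos_inj; rewrite [LHS]surjective_pairing [RHS]surjective_pairing.
  congr pair; last exact: Cc'.
  rewrite Ec !permM [h _](out_perm Dh) ?inE ?negbK ?perm_closed //.
  by rewrite -[LHS]/(rowf _) Rr Rr'.
apply: invg_inj; rewrite invg1; apply/permP => x; rewrite perm1.
have [Dx|D'x] := boolP (x \in D); first exact: fixD.
apply: col_inj; rewrite ?inE //; last exact: Cc'.
by apply: contra D'x => Dcx; rewrite -(perm_inj (fixD _ Dcx)).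
Qed.

Lemma sum_ge_term (T : finType) (A : {set T}) (F : T -> algC) i0 :
  i0 \in A -> (forall i, 0 <= F i) -> F i0 <= \sum_(i in A) F i.
Proof.
by move=> Ai0 F_ge0; rewrite (bigD1 i0) //= lerDl sumr_ge0.
Qed.

(** The signs disappear from the coefficient at 1, since only c = 1 contributes,
    and the term r = c = r' = h = 1 is positive. *)
Lemma strip_vector_neq0 : strip_vector != 0.
Proof.
suff : 0 < strip_vector 0 (gring_index (Symg n) 1%g).
  by apply: contraTneq => ->; rewrite mxE ltxx.
have -> : strip_vector 0 (gring_index (Symg n) 1%g)
  = \sum_(r in stab setT rowf) \sum_(c in stab setT colf)
      \sum_(r' in stab D rowf) \sum_(h in stab (~: D) (fun=> 0%N))
        (r * c * r' * h == 1)%g%:R.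
  rewrite /strip_vector (mul_stab_sumE (delta_mx _ _)) !mulmx_suml summxE.
  apply: eq_bigr => r Rr; rewrite delta_regular mul1g.
  rewrite (mul_alt_stab_sumE (delta_mx _ _)) !mulmx_suml summxE; apply: eq_bigr => c Cc.
  rewrite delta_regular -!scalemxAl mxE.
  rewrite (mul_stab_sumE (delta_mx _ _)) !mulmx_suml summxE mulr_sumr.
  apply: eq_bigr => r' Rr'; rewrite delta_regular.
  rewrite mul_stab_sumE summxE mulr_sumr; apply: eq_bigr => h Hh.
  rewrite delta_regular mxE eqxx /= (can_in_eq (@gring_indexK _ (Symg n))) ?inE //.
  rewrite eq_sym; case: eqP => [E|]; last by rewrite mulr0.
  by rewrite (strip_col_trivial Rr Cc Rr' Hh E) odd_perm1 mulr1.
apply: (lt_le_trans ltr01).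
do 4![apply: le_trans (sum_ge_term (group1 _) _);
  last by move=> *; do ?[apply: sumr_ge0 => *]; rewrite ler0n].
by rewrite !mulg1 eqxx.
Qed.

End StripVector.
End RegularRepresentation.

Section StripVectorEigen.

Variable n : nat.

Local Notation aG := (regular_repr algC (Symg n)).
Local Notation N := #|Symg n|.

Lemma tperm_sum_stab_comm (D E : {set 'I_n}) f :
    (forall g, g \in stab E f -> forall x, (g x \in D) = (x \in D)) ->
  stab_sum aG E f *m tperm_sum aG D = tperm_sum aG D *m stab_sum aG E f.
Proof.
move=> ED; rewrite /stab_sum mulmx_suml mulmx_sumr; apply: eq_bigr => g Eg.
by apply: tperm_sum_comm; apply: ED.
Qed.

Lemma tperm_sum_alt_stab_comm (D E : {set 'I_n}) f :
    (forall g, g \in stab E f -> forall x, (g x \in D) = (x \in D)) ->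
  alt_stab_sum aG E f *m tperm_sum aG D = tperm_sum aG D *m alt_stab_sum aG E f.
Proof.
move=> ED; rewrite /alt_stab_sum mulmx_suml mulmx_sumr; apply: eq_bigr => g Eg.
by rewrite -scalemxAl -scalemxAr tperm_sum_comm //; apply: ED.
Qed.

Lemma alt_stab_sumS (D : {set 'I_n}) f :
  alt_stab_sum aG setT f *m alt_stab_sum aG D f
  = #|stab D f|%:R *: alt_stab_sum aG setT f.
Proof.
apply: trmx_inj; rewrite trmx_mul linearZ /= !tr_alt_stab_sum.
rewrite [alt_stab_sum aG D f in LHS]/alt_stab_sum mulmx_suml.
rewrite (eq_bigr (fun=> alt_stab_sum aG setT f)) ?sumr_const ?scaler_nat // => c.
case/stabP=> _ fc; rewrite -scalemxAl mul_alt_stab_sum.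
  by rewrite scalerA -signr_addb addbb scale1r.
by apply/stabP; split=> //; apply/subsetP.
Qed.

Section Labelled.

Variables (D : {set 'I_n}) (pos : 'I_n -> nat * nat) (k : nat).
Variables (lam mu : seq nat).
Hypotheses (lam_part : is_partition k lam) (mu_part : is_partition n mu).
Hypotheses (labD : labelling D pos lam) (labT : labelling setT pos mu).

Let w := strip_vector D pos.

Lemma strip_vector_tperm_all : w *m tperm_sum aG setT = pair_sum mu *: w.
Proof.
have tT g x : (g x \in [set: 'I_n]) = (x \in [set: 'I_n]) by rewrite !inE.
have := tperm_sum_symmetrizer aG mu_part labT.
rewrite /w /strip_vector; set d := delta_mx _ _; set h := stab_sum aG (~: D) _.
set a' := stab_sum aG D _; set b := alt_stab_sum _ _ _; set a := stab_sum _ _ _.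
set t := tperm_sum _ _ => aTb.
have bT : b *m t = t *m b by apply: tperm_sum_alt_stab_comm.
have a'T : a' *m t = t *m a' by apply: tperm_sum_stab_comm.
have hT : h *m t = t *m h by apply: tperm_sum_stab_comm.
rewrite -[LHS]mulmxA hT mulmxA -[_ *m a' *m t]mulmxA a'T mulmxA.
rewrite -[_ *m b *m t]mulmxA bT mulmxA -(mulmxA d a) -(mulmxA d _ b) aTb.
by rewrite -scalemxAr -!scalemxAl mulmxA.
Qed.

(** The column sum of lam can be inserted, because it is absorbed by that of mu
    up to a nonzero factor; the Young symmetrizer of lam then appears. *)
Lemma strip_vector_tperm_sub : w *m tperm_sum aG D = pair_sum lam *: w.
Proof.
have tH g x : g \in stab (~: D) (fun=> 0%N) -> (g x \in D) = (x \in D).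
  case/stabP=> Dg _; apply: negb_inj; rewrite -!in_setC.
  by rewrite (perm_closed _ Dg).
have tD f g : g \in stab D f -> forall x, (g x \in D) = (x \in D).
  by case/stabP=> Dg _ x; rewrite (perm_closed _ Dg).
pose row x := (pos x).1; pose col x := (pos x).2.
set a := stab_sum aG D row; set b := alt_stab_sum aG D col.
set b' := alt_stab_sum aG setT col.
(* The scalar is known for row sum before column sum; transpose. *)
have ba : b *m tperm_sum aG D *m a = pair_sum lam *: (b *m a).
  apply: trmx_inj; rewrite !trmx_mul linearZ /= trmx_mul.
  rewrite tr_stab_sum tr_alt_stab_sum tr_tperm_sum mulmxA.
  exact: (tperm_sum_symmetrizer aG lam_part labD).
have b'a : b' *m a *m tperm_sum aG D = pair_sum lam *: (b' *m a).
  have card_n0 : #|stab D col|%:R != 0 :> algC.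
    by rewrite pnatr_eq0 -lt0n cardG_gt0.
  have bb : b' *m b = #|stab D col|%:R *: b' by apply: alt_stab_sumS.
  have aT : a *m tperm_sum aG D = tperm_sum aG D *m a.
    by apply: tperm_sum_stab_comm; apply: tD.
  apply: (scalerI card_n0); transitivity (b' *m b *m (a *m tperm_sum aG D)).
    by rewrite bb -!scalemxAl mulmxA.
  rewrite aT -mulmxA (mulmxA b) ba -scalemxAr mulmxA bb -!scalemxAl !scalerA.
  by rewrite mulrC.
rewrite /w /strip_vector -/row -/col -/a -/b'.
set d := delta_mx _ _; set h := stab_sum aG (~: D) _; set a1 := stab_sum aG setT _.
set t := tperm_sum _ _ in b'a *.
have hT : h *m t = t *m h.
  by apply: tperm_sum_stab_comm => g Hg x; apply: tH.
rewrite -[LHS]mulmxA hT mulmxA -(mulmxA _ b' a) -(mulmxA _ (b' *m a)) b'a.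
by rewrite -scalemxAr -scalemxAl.
Qed.

Lemma strip_vector_fixed g : perm_on (~: D) g -> w *m aG g = w.
Proof.
move=> Dg; have Hg : g \in stab (~: D) (fun=> 0%N) by apply/stabP.
by rewrite /w /strip_vector -[LHS]mulmxA (stab_sumM aG Hg).
Qed.

End Labelled.
End StripVectorEigen.

(** * Specht characters on transpositions *)

Lemma eigenspace_mxmodule (F : fieldType) (gT : finGroupType) (G : {group gT})
    (d : nat) (rG : mx_representation F G d) (t : 'M[F]_d) c :
    (forall g, g \in G -> rG g *m t = t *m rG g) -> mxmodule rG (eigenspace t c).
Proof.
move=> ct; apply/mxmoduleP=> g Gg; apply/eigenspaceP.
have /eigenspaceP E := submx_refl (eigenspace t c).
by rewrite -[LHS]mulmxA ct // mulmxA E scalemxAl.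
Qed.

Section SpechtTrace.

Variables (m : nat) (lam : seq nat).
Hypothesis lam_part : is_partition m lam.

Local Notation aG := (regular_repr algC (Symg m)).
Local Notation N := #|Symg m|.
Let y := young_symmetrizer m lam.
Let pos (x : 'I_m) := (reshape_index lam x, reshape_offset lam x).

Let lab : labelling setT pos lam.
Proof. by apply: reading_labelling; case/and3P: lam_part => _ _ /eqP. Qed.

Lemma reading_pos_inj : injective pos.
Proof. by move=> x x'; apply: (labelling_inj lab); rewrite inE. Qed.

Lemma young_symmetrizerE :
  y = delta_mx 0 (gring_index (Symg m) 1%g)
      *m stab_sum aG setT (fun x => (pos x).1)
      *m alt_stab_sum aG setT (fun x => (pos x).2).
Proof.
have onT g : perm_on [set: 'I_m] g by apply/subsetP.
rewrite mul_stab_sumE mulmx_suml /y /young_symmetrizer.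
apply: eq_big => [r|r _]; first by rewrite !inE onT.
rewrite mul_alt_stab_sumE; apply: eq_big => [c|c _]; first by rewrite !inE onT.
by rewrite !delta_regular mul1g.
Qed.

Lemma young_symmetrizer_neq0 : y != 0.
Proof.
have col_inj : {in ~: [set: 'I_m] &, injective (fun x => (pos x).2)}.
  by move=> x x'; rewrite setCT inE.
have := strip_vector_neq0 reading_pos_inj col_inj; rewrite /strip_vector.
rewrite -young_symmetrizerE; apply: contraNneq => ->.
by rewrite !mul0mx.
Qed.

Lemma young_symmetrizer_tperm : y *m tperm_sum aG setT = pair_sum lam *: y.
Proof.
have := tperm_sum_symmetrizer aG lam_part lab; rewrite young_symmetrizerE.
set d := delta_mx _ _; set b := alt_stab_sum _ _ _; set a := stab_sum _ _ _.
set t := tperm_sum _ _ => aTb.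
have bT : b *m t = t *m b.
  by apply: tperm_sum_alt_stab_comm => g _ x; rewrite !inE.
rewrite -[LHS]mulmxA bT mulmxA -(mulmxA d a) -(mulmxA d _ b) aTb.
by rewrite -scalemxAr mulmxA.
Qed.

(** The eigenspace of a central element is a submodule, so it suffices that it
    contains the generator of the Specht module. *)
Lemma specht_mx_tperm :
  specht_mx m lam *m tperm_sum aG setT = pair_sum lam *: specht_mx m lam.
Proof.
apply/eigenspaceP; apply: cyclic_mx_sub; last exact/eigenspaceP/young_symmetrizer_tperm.
apply: eigenspace_mxmodule => g _.
by apply: tperm_sum_comm => x; rewrite !inE.
Qed.

Lemma specht_char1_neq0 : specht_char m lam 1%g != 0.
Proof.
rewrite /specht_char cfRepr1 pnatr_eq0 mxrank_eq0 /specht_mx cyclic_mx_eq0.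
exact: young_symmetrizer_neq0.
Qed.

Lemma specht_char_tperm_sum :
  \sum_x \sum_x' specht_char m lam (tperm x x')
  = pair_sum lam * specht_char m lam 1%g.
Proof.
pose U := specht_mx m lam.
have -> : \sum_x \sum_x' specht_char m lam (tperm x x')
    = \tr (in_submod U (val_submod 1%:M *m tperm_sum aG setT)).
  rewrite /tperm_sum mulmx_sumr !linear_sum /=; apply: eq_big => [x|x _]; first by rewrite inE.
  rewrite mulmx_sumr !linear_sum /=; apply: eq_big => [x'|x' _]; first by rewrite inE.
  by rewrite /specht_char cfunE inE mulr1n.
have /eigenspaceP -> : (val_submod (1%:M : 'M_(\rank U))
    <= eigenspace (tperm_sum aG setT) (pair_sum lam))%MS.
  apply: submx_trans (val_submodP _) _; exact/eigenspaceP/specht_mx_tperm.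
by rewrite linearZ /= val_submodK linearZ /= mxtrace1 /specht_char cfRepr1.
Qed.

End SpechtTrace.

Lemma tperm_conj (T : finType) (i j x y : T) : i != j -> x != y ->
  exists s : {perm T}, (tperm i j ^ s)%g = tperm x y.
Proof.
move=> neq_ij neq_xy; exists (tperm i x * tperm (tperm i x j) y)%g.
rewrite tpermJ !permM tpermL tpermL tpermD //; last by rewrite eq_sym.
by apply: contraNneq neq_ij => /(canRL (tpermK i x)); rewrite tpermR => ->.
Qed.

(** Trace of [tperm_sum] on the Specht module.  All transpositions being
    conjugate, the m * (m - 1) off-diagonal terms have the same trace. *)
Lemma specht_pair_sum m lam (tau : 'S_m) :
    is_partition m lam -> ((1 < m)%N -> is_transposition tau) ->
  pair_sum lam = m%:R
    + ('C(m, 2)%:R * (specht_char m lam tau / specht_char m lam 1%g)) *+ 2.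
Proof.
move=> lam_part tauP; have chi1 := specht_char1_neq0 lam_part.
apply: (mulIf chi1); rewrite -specht_char_tperm_sum //.
set chi := specht_char m lam in chi1 *.
have Etau x x' : x != x' -> chi (tperm x x') = chi tau.
  move=> neq_x; have [|i [j [neq_ij ->]]] := tauP.
    rewrite -[m]card_ord; have := max_card (pred2 x x'); rewrite card2 neq_x.
    exact: leq_trans.
  have [s <-] := tperm_conj neq_ij neq_x; by rewrite cfunJ ?inE.
rewrite (eq_bigr (fun=> chi 1%g + (m.-1)%:R * chi tau)) => [|x _]; last first.
  rewrite (bigD1 x) //= tperm1 (eq_bigr (fun=> chi tau)) => [|x' neq_x].
    by rewrite sumr_const cardC1 card_ord mulr_natl.
  by rewrite Etau // eq_sym.
rewrite sumr_const card_ord -[_ *+ m]mulr_natl mulrDr mulrDl; congr (_ + _).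
have Em : m%:R * (m.-1)%:R = 'C(m, 2)%:R *+ 2 :> algC.
  rewrite -natrM -[RHS]mulrnA; congr _%:R.
  by rewrite -[RHS]mulnC -(mul_bin_diag m 1) bin1.
by rewrite mulrA Em -mulrnAl -[RHS]mulrA divfK.
Qed.

(** * Exchange of eigenvalues *)

Section Hermitian.

Variable N : nat.

Definition dot (u v : 'rV[algC]_N) : algC := (u *m (map_mx Num.conj v)^T) 0 0.

Definition hermitian (X : 'M[algC]_N) : Prop := (map_mx Num.conj X)^T = X.

Lemma dotDl u v w : dot (u + v) w = dot u w + dot v w.
Proof. by rewrite /dot mulmxDl mxE. Qed.

Lemma dotDr u v w : dot u (v + w) = dot u v + dot u w.
Proof. by rewrite /dot map_mxD linearD mulmxDr mxE. Qed.

Lemma dotZl a u v : dot (a *: u) v = a * dot u v.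
Proof. by rewrite /dot -scalemxAl mxE. Qed.

Lemma dotZr a u v : dot u (a *: v) = a^* * dot u v.
Proof. by rewrite /dot map_mxZ linearZ -scalemxAr mxE. Qed.

Lemma dotM X u v : hermitian X -> dot (u *m X) v = dot u (v *m X).
Proof. by move=> hX; rewrite /dot map_mxM trmx_mul hX mulmxA. Qed.

Lemma dot_eq0 u : (dot u u == 0) = (u == 0).
Proof.
apply/eqP/eqP=> [|->]; last by rewrite /dot mul0mx mxE.
rewrite /dot mxE => /eqP; rewrite psumr_eq0 => [/allP u0|i _]; last first.
  by rewrite !mxE -normCK exprn_ge0.
apply/rowP => i; have := u0 i (mem_index_enum i).
by rewrite !mxE -normCK expf_eq0 normr_eq0 => /eqP.
Qed.

Lemma hermitian_eig_real X (u : 'rV_N) a :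
  hermitian X -> u != 0 -> u *m X = a *: u -> a^* = a.
Proof.
move=> hX; rewrite -dot_eq0 => u0 uX.
by apply: (mulIf u0); rewrite -dotZr -uX -dotM // uX dotZl.
Qed.

Lemma hermitian_eig_orth X (u v : 'rV_N) a b :
    hermitian X -> u *m X = a *: u -> v *m X = b *: v -> v != 0 -> a != b ->
  dot u v = 0.
Proof.
move=> hX uX vX v0 neq_ab; have b_real := hermitian_eig_real hX v0 vX.
have /eqP : a * dot u v = b * dot u v by rewrite -dotZl -uX dotM // vX dotZr b_real.
by rewrite -subr_eq0 -mulrBl mulf_eq0 subr_eq0 (negPf neq_ab) => /eqP.
Qed.

(** [X], [Y] and [s] are two consecutive Jucys-Murphy elements and the adjacent
    transposition between them, with the relations of the degenerate affine Hecke
    algebra; [u] is an eigenvector of [X] and [Y]. *)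
Section Exchange.

Variables (X Y s : 'M[algC]_N).
Hypotheses (hX : hermitian X) (hs : hermitian s) (ss : s *m s = 1%:M).
Hypotheses (sX : s *m X = Y *m s - 1%:M) (sY : s *m Y = X *m s + 1%:M).

Variables (u : 'rV[algC]_N) (a b : algC).
Hypotheses (u0 : u != 0) (uX : u *m X = a *: u) (uY : u *m Y = b *: u).

(** If a = b then u s (X - a) = - u; pairing with u, which is killed by X - a on
    the other side, gives dot u u = 0. *)
Lemma exchange_neq : a != b.
Proof.
apply: contraNneq u0 => Eab; rewrite -dot_eq0.
have a_real := hermitian_eig_real hX u0 uX.
have E : dot (u *m s *m X) u = a * dot (u *m s) u by rewrite dotM // uX dotZr a_real.
move: E; rewrite -mulmxA sX mulmxBr mulmx1 mulmxA uY -Eab -scalemxAl.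
rewrite -scaleN1r dotDl !dotZl mulN1r => /eqP.
by rewrite -subr_eq0 addrC addKr oppr_eq0.
Qed.

(** The intertwiner of the degenerate affine Hecke algebra, applied to u. *)
Definition exchange : 'rV[algC]_N := u *m s - (b - a)^-1 *: u.

Lemma exchangeX : exchange *m X = b *: exchange.
Proof.
have neq_ba : b - a != 0 by rewrite subr_eq0 eq_sym exchange_neq.
rewrite /exchange mulmxBl -mulmxA sX mulmxBr mulmx1 mulmxA uY -!scalemxAl uX.
rewrite scalerBr -addrA; congr (_ + _).
by rewrite -[X in - X - _]scale1r -opprD !scalerA -scalerDl; congr (- (_ *: _)); field.
Qed.

Lemma exchangeY : exchange *m Y = a *: exchange.
Proof.
have neq_ba : b - a != 0 by rewrite subr_eq0 eq_sym exchange_neq.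
rewrite /exchange mulmxBl -mulmxA sY mulmxDr mulmx1 mulmxA uX -!scalemxAl uY.
rewrite scalerBr -addrA; congr (_ + _).
by rewrite -[X in X - _]scale1r !scalerA -scalerBl -scaleNr; congr (_ *: _); field.
Qed.

Lemma exchange_neq0 : b != a + 1 -> a != b + 1 -> exchange != 0.
Proof.
move=> neq1 neq2; apply: contraNneq neq1 => /eqP; rewrite subr_eq0 => /eqP us.
have neq_ba : b - a != 0 by rewrite subr_eq0 eq_sym exchange_neq.
have : u *m s *m s = u by rewrite -mulmxA ss mulmx1.
rewrite us -scalemxAl us scalerA -{2}[u]scale1r => /eqP.
rewrite -subr_eq0 -scalerBl scaler_eq0 (negPf u0) orbF subr_eq0 -invfM.
rewrite invr_eq1 -expr2 sqrf_eq1 => /orP[|] /eqP E.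
  by rewrite -E addrC subrK.
by case/eqP: neq2; rewrite -[1]opprK -E; ring.
Qed.

(** If b - a is 1 or - 1 then u s = exchange + (b - a) u with orthogonal
    summands, and u s has the same norm as u, so that [exchange] vanishes. *)
Lemma exchange_adjacent : (b == a + 1) || (a == b + 1) -> u *m s = (b - a) *: u.
Proof.
move=> adj; have neq_ba : b - a != 0 by rewrite subr_eq0 eq_sym exchange_neq.
have E : (b - a) ^+ 2 = 1.
  by case/orP: adj => /eqP->; ring.
have inv : (b - a)^-1 = b - a by apply: (mulfI neq_ba); rewrite divff // -expr2.
apply/eqP; rewrite -subr_eq0 -inv -/exchange -dot_eq0.
have [->|e0] := eqVneq exchange 0; first by rewrite /dot mul0mx mxE.
(* Reality of b comes from the eigenvector exchange itself. *)
have d_real : (b - a)^* = b - a.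
  by rewrite rmorphB /= (hermitian_eig_real hX u0 uX) (hermitian_eig_real hX e0 exchangeX).
have orth1 : dot u exchange = 0.
  exact: hermitian_eig_orth hX uX exchangeX e0 exchange_neq.
have orth2 : dot exchange u = 0.
  by apply: hermitian_eig_orth hX exchangeX uX u0 _; rewrite eq_sym exchange_neq.
have us : u *m s = exchange + (b - a) *: u by rewrite /exchange inv subrK.
have : dot (u *m s) (u *m s) = dot u u by rewrite dotM // -mulmxA ss mulmx1.
move: exchange us orth1 orth2 {e0} => e us orth1 orth2.
rewrite us dotDl !dotDr !dotZl !dotZr orth1 orth2 !mulr0 addr0 add0r d_real.
by rewrite mulrA -expr2 E mul1r => /eqP; rewrite -subr_eq0 addrK.
Qed.

End Exchange.
End Hermitian.

(** * Jucys-Murphy elements *)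

Section JucysMurphy.

Variable n : nat.

Local Notation aG := (regular_repr algC (Symg n)).
Local Notation N := #|Symg n|.

Lemma hermitian_regular (g : 'S_n) : (g^-1 = g)%g -> hermitian (aG g).
Proof.
move=> Eg; rewrite /hermitian map_trmx tr_regular_repr Eg.
by apply/matrixP=> i j; rewrite mxE !regular_reprE rmorph_nat.
Qed.

Definition below (j : nat) : {set 'I_n} := [set x : 'I_n | (x < j)%N].

(** This form, in terms of sums that are central in a smaller symmetric group,
    makes commutation immediate; [jmE] gives the usual one. *)
Definition jm (j : nat) : 'M[algC]_N :=
  2%:R^-1 *: (tperm_sum aG (below j.+1) - tperm_sum aG (below j) - 1%:M).

Lemma jmE (j : 'I_n) : jm j = \sum_(l in below j) aG (tperm l j).
Proof.
have jb : j \notin below j by rewrite inE ltnn.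
have E : below j.+1 = j |: below j.
  by apply/setP => x; rewrite !inE ltnS leq_eqVlt.
set z := \sum_(l in below j) _; set t := tperm_sum aG (below j).
have Et : tperm_sum aG (below j.+1) = 1%:M + z + (z + t).
  rewrite /tperm_sum E (big_setU1 _ jb); congr (_ + _).
    rewrite (big_setU1 _ jb) tperm1 repr_mx1; congr (_ + _).
    by apply: eq_bigr => l _; rewrite tpermC.
  by rewrite -big_split; apply: eq_bigr => l _; rewrite (big_setU1 _ jb).
have -> : jm j = 2%:R^-1 *: (2%:R *: z).
  rewrite /jm -/t Et scaler_nat mulr2n addrA addrK; congr (_ *: _).
  by rewrite -[1%:M + z + z]addrA addrAC subrr add0r.
by rewrite scalerA mulVf ?scale1r // pnatr_eq0.
Qed.

Lemma hermitian_jm j : (j < n)%N -> hermitian (jm j).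
Proof.
move=> lt_j; rewrite -[j]/(val (Ordinal lt_j)) jmE /hermitian !raddf_sum /=.
by apply: eq_bigr => l _; apply: hermitian_regular; rewrite tpermV.
Qed.

Lemma jm0 : (0 < n)%N -> jm 0 = 0.
Proof.
move=> n0; rewrite -[X in jm X]/(val (Ordinal n0)) jmE big1 // => l.
by rewrite inE ltn0.
Qed.

Section Adjacent.

Variables (x y : 'I_n).
Hypothesis xy : y = x.+1 :> nat.

Local Notation s := (aG (tperm x y)).

Lemma adjacent_sqr : s *m s = 1%:M.
Proof. by rewrite -sym_reprM tperm2 repr_mx1. Qed.

Lemma hermitian_adjacent : hermitian s.
Proof. by apply: hermitian_regular; rewrite tpermV. Qed.

Lemma adjacent_tperm_sum j : j != y :> nat ->
  s *m tperm_sum aG (below j) = tperm_sum aG (below j) *m s.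
Proof.
move=> neq_j; apply: tperm_sum_comm => z; rewrite !inE.
by case: tpermP => // ->; apply/idP/idP; lia.
Qed.

Lemma adjacent_jm j : j != x :> nat -> j != y :> nat -> s *m jm j = jm j *m s.
Proof.
move=> neq_x neq_y; rewrite /jm -scalemxAl -scalemxAr; congr (_ *: _).
rewrite !mulmxBl !mulmxBr mul1mx mulmx1 !adjacent_tperm_sum //.
by rewrite xy eqSS.
Qed.

Lemma jm_next : jm y = s *m jm x *m s + s.
Proof.
rewrite !jmE; have -> : below y = x |: below x.
  by apply/setP => z; rewrite !inE xy ltnS leq_eqVlt.
rewrite big_setU1 ?inE ?ltnn //= addrC; congr (_ + _).
rewrite mulmx_sumr mulmx_suml; apply: eq_bigr => l; rewrite inE => lt_l.
have lx : x != l by apply: contraTneq lt_l => ->; rewrite ltnn.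
have ly : y != l by apply: contraTneq lt_l => <-; rewrite xy ltnNge leqnSn.
rewrite -!sym_reprM; congr (aG _); have := tpermJ l x (tperm x y).
by rewrite tpermL tpermD // conjgE tpermV mulgA.
Qed.

Lemma adjacent_jml : s *m jm x = jm y *m s - 1%:M.
Proof. by rewrite jm_next mulmxDl -(mulmxA _ s s) adjacent_sqr mulmx1 addrK. Qed.

Lemma adjacent_jmr : s *m jm y = jm x *m s + 1%:M.
Proof. by rewrite jm_next mulmxDr !mulmxA adjacent_sqr mul1mx. Qed.

End Adjacent.

End JucysMurphy.

(** * Joint eigenvalues of the Jucys-Murphy elements *)

(** Number of pairs to be exchanged in order to sort a sequence decreasingly: it
    measures the progress in [occurs_increasing]. *)
Fixpoint inversions (s : seq int) : nat :=
  if s is a :: s' then (count (fun b => (a < b)%R) s' + inversions s')%N else 0%N.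

Lemma inversions_swap p a b q : a < b ->
  inversions (p ++ a :: b :: q) = (inversions (p ++ b :: a :: q)).+1.
Proof.
move=> lt_ab; elim: p => [|c p IH] /=.
  by rewrite lt_ab (lt_gtF lt_ab); lia.
by rewrite IH !count_cat /= addnS; congr (_ + _).+1; lia.
Qed.

Lemma not_sorted_split (T : Type) (r : rel T) s : ~~ sorted r s ->
  exists p a b q, s = p ++ a :: b :: q /\ ~~ r a b.
Proof.
elim: s => // a [|b s] IH //=; rewrite negb_and.
case: (boolP (r a b)) => [_ /= /IH[p [a' [b' [q [-> nr]]]]]|nr _].
  by exists (a :: p), a', b', q.
by exists [::], a, b, s.
Qed.

Section JointSpectrum.

Variable n : nat.

Local Notation aG := (regular_repr algC (Symg n)).
Local Notation N := #|Symg n|.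

(** The eigenvalues are listed in the order of the Jucys-Murphy elements, hence
    in the reverse of the order of [contents]. *)
Definition joint_eigen (u : 'rV[algC]_N) (t : seq algC) : Prop :=
  forall j, (j < size t)%N -> u *m jm n j = t`_j *: u.

Lemma joint_eigen_catl u t1 t2 : joint_eigen u (t1 ++ t2) -> joint_eigen u t1.
Proof.
move=> ut j lt_j; rewrite ut ?nth_cat ?lt_j //.
by rewrite size_cat (leq_trans lt_j) ?leq_addr.
Qed.

Section AdjacentEigenvalues.

Variables (u : 'rV[algC]_N) (q p : seq algC) (a b : algC).
Hypotheses (u0 : u != 0) (ut : joint_eigen u (q ++ a :: b :: p)).
Variables (x y : 'I_n).
Hypotheses (xq : x = size q :> nat) (yx : y = x.+1 :> nat).

Local Notation s := (aG (tperm x y)).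

Let size_t : size (q ++ a :: b :: p) = (size q + (size p).+2)%N.
Proof. by rewrite size_cat. Qed.

Let uX : u *m jm n x = a *: u.
Proof. by rewrite xq ut ?size_t ?nth_cat ?ltnn ?subnn //; lia. Qed.

Let uY : u *m jm n y = b *: u.
Proof.
rewrite yx xq ut ?size_t; last by lia.
by rewrite nth_cat ltnNge leqnSn subSnn.
Qed.

Let hX : hermitian (jm n x). Proof. exact: hermitian_jm. Qed.
Let hs : hermitian s. Proof. exact: hermitian_adjacent. Qed.
Let ss : s *m s = 1%:M. Proof. exact: adjacent_sqr. Qed.
Let sX : s *m jm n x = jm n y *m s - 1%:M. Proof. exact: adjacent_jml. Qed.
Let sY : s *m jm n y = jm n x *m s + 1%:M. Proof. exact: adjacent_jmr. Qed.

Lemma adjacent_neq : a != b.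
Proof. exact: (exchange_neq hX sX u0 uX uY). Qed.

Lemma adjacent_fixed : (b == a + 1) || (a == b + 1) -> u *m s = (b - a) *: u.
Proof. exact: (exchange_adjacent hX hs ss sX u0 uX uY). Qed.

Lemma exchange_joint : joint_eigen (exchange s u a b) (q ++ b :: a :: p).
Proof.
move=> j; have -> : size (q ++ b :: a :: p) = size (q ++ a :: b :: p).
  by rewrite !size_cat.
move=> lt_j; have [Ex|neq_x] := eqVneq j x.
  rewrite Ex (exchangeX hX sX u0 uX uY) xq; congr (_ *: _).
  by rewrite nth_cat ltnn subnn.
have [Ey|neq_y] := eqVneq j y.
  rewrite Ey (exchangeY hX sX sY u0 uX uY) yx xq; congr (_ *: _).
  by rewrite nth_cat ltnNge leqnSn subSnn.
have nthE : (q ++ b :: a :: p)`_j = (q ++ a :: b :: p)`_j.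
  rewrite !nth_cat; case: ltnP => // le_qj.
  have [d Ej] : exists d, j = (size q + d.+2)%N.
    by move: neq_x neq_y; rewrite -xq in le_qj *; exists (j - x - 2)%N; lia.
  by rewrite Ej addKn.
rewrite /exchange mulmxBl -mulmxA adjacent_jm // mulmxA -!scalemxAl ut //.
by rewrite nthE -scalemxAl scalerBr !scalerA [_^-1 * _]mulrC.
Qed.

Lemma exchange_joint_neq0 :
  b != a + 1 -> a != b + 1 -> exchange s u a b != 0.
Proof. exact: (exchange_neq0 hX ss sX u0 uX uY). Qed.

End AdjacentEigenvalues.

Definition spectrum (s : seq algC) : Prop :=
  (size s <= n)%N /\ exists2 u, u != 0 & joint_eigen u (rev s).

Let rev_split (T : Type) (p : seq T) a b q :
  rev (p ++ b :: a :: q) = rev q ++ a :: b :: rev p.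
Proof. by rewrite rev_cat !rev_cons -!cats1 -!catA. Qed.

Let adjacent_ord (T : Type) (p q : seq T) a b :
    (size (p ++ b :: a :: q) <= n)%N ->
  exists x y : 'I_n, x = size (rev q) :> nat /\ y = x.+1 :> nat.
Proof.
rewrite size_cat /= => sz; rewrite size_rev.
have lt_x : (size q < n)%N by lia.
have lt_y : ((size q).+1 < n)%N by lia.
by exists (Ordinal lt_x), (Ordinal lt_y).
Qed.

Lemma spectrum_first p x : spectrum (rcons p x) -> x = 0.
Proof.
rewrite /spectrum rev_rcons size_rcons => -[sz [u u0 ux]].
have := ux 0%N isT; rewrite jm0 ?(leq_trans _ sz) // mulmx0 /= => /esym/eqP.
by rewrite scaler_eq0 (negPf u0) orbF => /eqP.
Qed.

Lemma spectrum_eq p x q : ~ spectrum (p ++ x :: x :: q).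
Proof.
move=> [sz [u u0]]; rewrite rev_split => ut.
have [i [j [Ei Ej]]] := adjacent_ord sz.
by have := adjacent_neq u0 ut Ei Ej; rewrite eqxx.
Qed.

Lemma spectrum_swap (p : seq algC) (x y : algC) (q : seq algC) :
  x != y + 1 -> y != x + 1 ->
  spectrum (p ++ y :: x :: q) -> spectrum (p ++ x :: y :: q).
Proof.
move=> neq1 neq2 [sz [u u0]]; rewrite rev_split => ut.
have [i [j [Ei Ej]]] := adjacent_ord sz.
split; first by move: sz; rewrite !size_cat.
exists (exchange (aG (tperm i j)) u x y).
  exact: (exchange_joint_neq0 u0 ut Ei Ej).
by rewrite rev_split; apply: exchange_joint.
Qed.

(** In the pattern x, y, x with y - x = e = 1 or - 1, the two adjacent
    transpositions act on u by the scalars e and - e, against the braid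
    relation. *)
Let spectrum_braid p (x y : algC) q :
  (y == x + 1) || (x == y + 1) -> ~ spectrum (p ++ x :: y :: x :: q).
Proof.
move=> adj [sz [u u0 ut]].
have [lt_i lt_j lt_k] : [/\ size q < n, (size q).+1 < n & (size q).+2 < n]%N.
  by move: sz; rewrite size_cat /=; split; lia.
pose i := Ordinal lt_i; pose j := Ordinal lt_j; pose k := Ordinal lt_k.
rewrite rev_cat !rev_cons -!cats1 -!catA in ut.
have us1 : u *m aG (tperm i j) = (y - x) *: u.
  apply: (@adjacent_fixed u (rev q) (x :: rev p) x y) => //; by rewrite size_rev.
have us2 : u *m aG (tperm j k) = (x - y) *: u.
  apply: (@adjacent_fixed u (rcons (rev q) x) (rev p) y x) => //.
  - by rewrite cat_rcons.
  - by rewrite size_rcons size_rev.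
  - by rewrite orbC.
have [nij nik njk] : [/\ i != j, i != k & j != k].
  by rewrite -!val_eqE /=; split; lia.
have braid : (tperm i j * tperm j k * tperm i j = tperm j k * tperm i j * tperm j k)%g.
  have := tpermJ j k (tperm i j); rewrite tpermR tpermD //.
  have := tpermJ i j (tperm j k); rewrite tpermL tpermD 1?[_ == i]eq_sym //.
  by rewrite !conjgE !tpermV !mulgA => -> ->.
have e2 : (y - x) ^+ 2 = 1 by case/orP: adj => /eqP->; ring.
have : u *m aG (tperm i j * tperm j k * tperm i j)%g
     = u *m aG (tperm j k * tperm i j * tperm j k)%g by rewrite braid.
rewrite !sym_reprM !mulmxA us1 -!scalemxAl us2 -!scalemxAl us1 -!scalemxAl us2 !scalerA.
have -> : (y - x) * (x - y) * (y - x) = - (y - x) by rewrite -[RHS]mulr1 -e2; ring.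
have -> : (x - y) * (y - x) * (x - y) = y - x by rewrite -[RHS]mulr1 -e2; ring.
move=> /eqP; rewrite -subr_eq0 -scalerBl scaler_eq0 (negPf u0) orbF -opprD oppr_eq0.
rewrite -mulr2n mulrn_eq0 /= => /eqP E.
by move: e2; rewrite E expr0n /= => /esym/eqP; rewrite oner_eq0.
Qed.

Lemma spectrum_contents_regular s : spectrum s ->
  exists2 w, lattice w & s = map intr (contents w).
Proof.
apply: spectrum_contents.
- exact: spectrum_first.
- exact: spectrum_eq.
- exact: spectrum_swap.
- by move=> p x q; apply: spectrum_braid; rewrite eqxx.
- by move=> p x q; apply: spectrum_braid; rewrite eqxx orbT.
Qed.

Lemma joint_eigen_tperm_sum u (w : seq nat) :
    lattice w -> joint_eigen u (rev (map intr (contents w))) ->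
  u *m tperm_sum aG (below n (size w)) = pair_sum (word_shape w) *: u.
Proof.
move=> Lw; rewrite pair_sum_word //.
have -> : size w = size (contents w).
  by rewrite size_map; elim: (w) => //= i w' ->.
elim: (contents w) => [|c s IH] /=.
  rewrite big_nil mul0rn addr0 scale0r /tperm_sum big1 ?mulmx0 // => x.
  by rewrite inE ltn0.
rewrite rev_cons -cats1 => us; rewrite big_cons.
have := us (size s); rewrite size_cat size_rev size_map addn1 => /(_ (ltnSn _)).
rewrite nth_cat size_rev size_map ltnn subnn /= => uc.
have Es : tperm_sum aG (below n (size s).+1)
    = tperm_sum aG (below n (size s)) + 1%:M + 2%:R *: jm n (size s).
  rewrite /jm scalerA divff ?pnatr_eq0 // scale1r -[_ - _ - 1%:M]addrA.
  by rewrite -opprD [RHS]addrC subrK.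
rewrite Es !mulmxDr mulmx1 -scalemxAr uc (IH (joint_eigen_catl us)).
rewrite -[X in _ + X + _]scale1r scalerA -!scalerDl; congr (_ *: _).
by rewrite -addn1 natrD; ring.
Qed.

Lemma jm_comm i j : jm n i *m jm n j = jm n j *m jm n i.
Proof.
have tt i' j' : (i' <= j')%N ->
    tperm_sum aG (below n i') *m tperm_sum aG (below n j')
    = tperm_sum aG (below n j') *m tperm_sum aG (below n i').
  move=> le_ij; rewrite [tperm_sum aG (below n i')]/tperm_sum.
  rewrite mulmx_suml mulmx_sumr; apply: eq_bigr => x; rewrite inE => lt_x.
  rewrite mulmx_suml mulmx_sumr; apply: eq_bigr => y; rewrite inE => lt_y.
  apply: tperm_sum_comm => z; rewrite !inE; case: tpermP => // ->;
  by rewrite (leq_trans lt_x le_ij) (leq_trans lt_y le_ij).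
have {}tt i' j' : tperm_sum aG (below n i') *m tperm_sum aG (below n j')
    = tperm_sum aG (below n j') *m tperm_sum aG (below n i').
  by case/orP: (leq_total i' j') => /tt.
rewrite /jm -!scalemxAl -!scalemxAr; congr (_ *: (_ *: _)).
have c1 (A : 'M[algC]_N) : comm_mx A 1%:M by rewrite /comm_mx mulmx1 mul1mx.
apply: comm_mxB (c1 _); apply: comm_mx_sym; apply: comm_mxB (c1 _).
apply: comm_mxB; apply: comm_mx_sym; apply: comm_mxB; exact: tt.
Qed.

(** Commuting hermitian matrices are simultaneously diagonalizable. *)
Lemma joint_eigenbasis :
  exists2 P : 'M[algC]_N, P \in unitmx
    & forall i, exists2 t, size t = n & joint_eigen (row i P) t.
Proof.
pose Xs := [seq jm n j | j <- iota 0 n].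
have [|P Punit /allP PX] := (codiagonalizableP Xs).1.
  split=> [A B /mapP[i _ ->] /mapP[j _ ->]|A /mapP[j]]; first exact: jm_comm.
  rewrite mem_iota /= add0n => lt_j ->.
  have /orthomx_spectralP E : jm n j \is normalmx.
    by apply/normalmxP; rewrite -map_trmx (hermitian_jm lt_j).
  exists (spectralmx (jm n j)); first exact: spectral_unit.
  apply/diagonalizable_forPex; exists (spectral_diag (jm n j)).
  by apply/simmxP; rewrite ?spectral_unit // {2}E -!mulmxA mulKVmx ?spectral_unit.
exists P => // i; pose c j := (row i P *m jm n j *m invmx P) 0 i.
exists (mkseq c n) => [|j]; first by rewrite size_mkseq.
rewrite size_mkseq => lt_j; rewrite nth_mkseq //.
have /PX /diagonalizable_forPex[D /(simmxP Punit) ED] : jm n j \in Xs.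
  by apply: map_f; rewrite mem_iota.
have ErD : row i P *m jm n j = D 0 i *: row i P.
  by rewrite -row_mul ED row_mul row_diag_mx -scalemxAl -rowE.
rewrite /c ErD -scalemxAl -row_mul mulmxV // mxE mxE mxE eqxx mulr1 //.
Qed.

Section Occurring.

Variables (v : 'rV[algC]_N) (k : nat).
Hypotheses (v0 : v != 0) (le_kn : (k <= n)%N).
Hypothesis v_fixed : forall x y : 'I_n,
  (k <= x)%N -> y = x.+1 :> nat -> v *m aG (tperm x y) = v.

(** The joint eigenvalue sequences that contribute to [v].  The bilinear pairing
    u v^T is enough, and it is invariant under the symmetric matrices at hand. *)
Definition occurs (t : seq algC) : Prop :=
  size t = n /\ exists2 u, joint_eigen u t & u *m v^T != 0.

Lemma occurs_exists : exists t, occurs t.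
Proof.
have [P Punit PX] := joint_eigenbasis.
have /rV0Pn[i] : (P *m v^T)^T != 0.
  apply: contraNneq v0 => /(congr1 trmx); rewrite trmxK trmx0 => E.
  by rewrite -[v]trmxK -(mulKmx Punit v^T) E mulmx0 trmx0.
rewrite mxE => Pvi; have [t sz_t ut] := PX i.
exists t; split=> //; exists (row i P) => //.
apply: contraNneq Pvi => E.
have := congr1 (fun M : 'M_1 => M 0 0) E.
by rewrite -row_mul !mxE => ->.
Qed.

Lemma occurs_neq0 (u : 'rV_N) : u *m v^T != 0 -> u != 0.
Proof. by apply: contraNneq => ->; rewrite mul0mx. Qed.

Lemma occurs_contents t : occurs t ->
  exists2 w, lattice w & t = rev (map intr (contents w)).
Proof.
move=> [sz_t [u ut uv]]; have [|w Lw E] := @spectrum_contents_regular (rev t).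
  split; first by rewrite size_rev sz_t.
  by exists u; rewrite ?revK //; apply: occurs_neq0.
by exists w; rewrite // -E revK.
Qed.

(** The adjacent transposition s fixes [v], so (u s) v^T = u v^T.  If a = b + 1
    then u s = - u, a contradiction; otherwise the pairing of the exchanged vector
    with [v] is (1 - 1 / (b - a)) u v^T. *)
Lemma occurs_swap q a b p : occurs (q ++ a :: b :: p) -> (k <= size q)%N ->
  [/\ a != b, a != b + 1 & b != a + 1 -> occurs (q ++ b :: a :: p)].
Proof.
move=> [sz_t [u ut uv]] le_kq; have u0 := occurs_neq0 uv.
have [lt_x lt_y] : (size q < n)%N /\ ((size q).+1 < n)%N.
  by move: sz_t; rewrite size_cat /=; lia.
pose x := Ordinal lt_x; pose y := Ordinal lt_y.
have usv : u *m aG (tperm x y) *m v^T = u *m v^T.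
  rewrite -mulmxA; congr (_ *m _); apply: trmx_inj.
  by rewrite trmx_mul trmxK tr_regular_repr tpermV v_fixed.
split; first exact: (@adjacent_neq u q p a b u0 ut x y).
  apply/eqP => Eab; have us : u *m aG (tperm x y) = (b - a) *: u.
    by apply: (@adjacent_fixed u q p a b u0 ut x y) => //; rewrite Eab eqxx orbT.
  case/eqP: uv; move: usv; rewrite us -scalemxAl => /eqP.
  rewrite -subr_eq0 -{2}[u *m _]scale1r -scalerBl scaler_eq0 => /orP[|/eqP //].
  have -> : b - a - 1 = - 2%:R by rewrite Eab; ring.
  by rewrite oppr_eq0 pnatr_eq0.
move=> neq_ba; split; first by move: sz_t; rewrite !size_cat.
exists (exchange (aG (tperm x y)) u a b); first exact: exchange_joint.
have neq : b - a != 0 by rewrite subr_eq0 eq_sym (@adjacent_neq u q p a b u0 ut x y).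
rewrite /exchange mulmxBl usv -scalemxAl -{1}[u *m _]scale1r -scalerBl.
rewrite scaler_eq0 negb_or uv andbT subr_eq0 eq_sym invr_eq1.
by apply: contra neq_ba => /eqP <-; rewrite addrC subrK.
Qed.

(** Bubble sort: as long as two neighbouring eigenvalues at the last n - k points
    decrease, they decrease by at least 2 and can be exchanged. *)
Lemma occurs_increasing : exists w,
  [/\ lattice w, sorted (fun a b : int => b < a) (take (n - k) (contents w))
     & occurs (rev (map intr (contents w)))].
Proof.
have [t /[dup] Ot /occurs_contents[w Lw Et]] := occurs_exists.
rewrite {t}Et in Ot; have [m] := ubnP (inversions (contents w)).
elim: m w Lw Ot => // m IH w Lw Ow; rewrite ltnS => le_m.
(* The contents are listed backwards, whence the reversed order. *)
have [srt|] := boolP (sorted (fun a b : int => b < a) (take (n - k) (contents w))).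
  by exists w.
case/not_sorted_split=> p [b [a [q [E]]]]; rewrite -leNgt => le_ba.
have sz_c : size (contents w) = n by case: Ow; rewrite size_rev size_map.
pose q' := q ++ drop (n - k) (contents w).
have Ec : contents w = p ++ b :: a :: q'.
  by rewrite -[LHS](cat_take_drop (n - k)) E -catA.
have le_k : (k <= size (rev (map intr q' : seq algC)))%N.
  by rewrite size_rev size_map size_cat size_drop sz_c; lia.
have rev_map (x y : int) : rev (map intr (p ++ x :: y :: q'))
    = rev (map intr q') ++ y%:~R :: x%:~R :: rev (map intr p) :> seq algC.
  by rewrite map_cat /= rev_split.
rewrite Ec rev_map in Ow; have [neq_ab neq_ab1 swapped] := occurs_swap Ow le_k.
have lt_ba : b < a.
  by rewrite lt_neqAle le_ba andbT; apply: contraNneq neq_ab => ->.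
have {}/swapped Ow' : (b%:~R : algC) != a%:~R + 1.
  by apply: intr_neqS; lia.
rewrite -rev_map in Ow'; have [w' Lw' Ew'] := occurs_contents Ow'.
have Ec' : contents w' = p ++ a :: b :: q'.
  apply: (inj_map (@intr_inj algC)); exact/esym/(can_inj revK Ew').
apply: (IH w') => //; first by rewrite Ec'.
by rewrite Ec'; move: le_m; rewrite Ec inversions_swap.
Qed.

(** The matrix applied to v is symmetric, so a joint eigenvector u with
    u v^T <> 0 has the same eigenvalue, which is a difference of content sums. *)
Lemma fixed_eigenvalue beta :
    v *m (tperm_sum aG setT - tperm_sum aG (below n k)) = beta *: v ->
  exists lam mu, [/\ is_partition k lam, is_partition n mu, prec lam mu
                   & beta = pair_sum mu - pair_sum lam].
Proof.
move=> v_beta; have [w [Lw srt [sz_w [u uw uv]]]] := occurs_increasing.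
have sz_c : size (contents w) = size w.
  by rewrite size_map; elim: (w) => //= i w' ->.
rewrite size_rev size_map sz_c in sz_w.
pose q := drop (n - k) w; pose p := take (n - k) w.
have Ew : w = p ++ q by rewrite cat_take_drop.
have sz_q : size q = k by rewrite size_drop sz_w; lia.
have sz_p : size p = (n - k)%N by rewrite size_takel // sz_w leq_subr.
have Lq : lattice q by move: Lw; rewrite Ew; elim: (p) => //= i p' IH /andP[/IH].
have Ecq : contents w = take (n - k) (contents w) ++ contents q.
  rewrite -{1}(cat_take_drop (n - k) (contents w)); congr (_ ++ _).
  rewrite /contents -map_drop Ew -sz_p; congr map.
  by elim: (p) => //=; rewrite drop0.
exists (word_shape q), (word_shape w); split.
- by rewrite -sz_q word_shape_partition.
- by rewrite -sz_w word_shape_partition.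
- by rewrite [X in prec _ (word_shape X)]Ew; apply: increasing_contents_prec; rewrite -Ew ?sz_p.
have um := joint_eigen_tperm_sum Lw uw.
have ul : u *m tperm_sum aG (below n k) = pair_sum (word_shape q) *: u.
  rewrite -sz_q; apply: joint_eigen_tperm_sum Lq _.
  by move: uw; rewrite Ecq map_cat rev_cat; apply: joint_eigen_catl.
have En : below n (size w) = setT by apply/setP => x; rewrite !inE sz_w ltn_ord.
rewrite En in um.
have : u *m (beta *: v)^T = (pair_sum (word_shape w) - pair_sum (word_shape q)) *: (u *m v^T).
  by rewrite -v_beta trmx_mul linearB /= !tr_tperm_sum mulmxA mulmxBr um ul
             -scalerBl scalemxAl.
rewrite linearZ /= -scalemxAr => /eqP; rewrite -subr_eq0 -scalerBl scaler_eq0.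
by rewrite (negPf uv) orbF subr_eq0 => /eqP.
Qed.

End Occurring.
End JointSpectrum.

(** * The arrangement graph *)

Lemma binomial_half (m : nat) : 'C(m, 2)%:R *+ 2 = (m ^ 2)%:R - m%:R :> algC.
Proof.
rewrite -mulrnA mulnC -(mul_bin_diag m 1) bin1 -natrB; last by case: m => // m; lia.
by congr _%:R; nia.
Qed.

Section Arrangement.

Variables (n k : nat).
Hypothesis le_kn : (k <= n)%N.

Local Notation aG := (regular_repr algC (Symg n)).
Local Notation N := #|Symg n|.
Local Notation K := #|{: kperm k n}|.
Local Notation w := (widen_ord le_kn).

Definition coord (u : 'rV[algC]_N) (g : 'S_n) : algC :=
  u 0 (gring_index (Symg n) g).

Lemma coord_inj u v : coord u =1 coord v -> u = v.
Proof.
move=> E; apply/rowP => j; rewrite -[j](@gring_valK _ (Symg n)); exact: E.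
Qed.

Lemma coord_regular u g h : coord (u *m aG h) g = coord u (g * h^-1)%g.
Proof.
rewrite /coord -[u *m _]trmxK trmx_mul tr_regular_repr mxE.
have -> : (aG h^-1%g *m u^T) (gring_index (Symg n) g) 0
    = (row (gring_index (Symg n) g) (aG h^-1%g) *m u^T) 0 0.
  by rewrite -row_mul [RHS]mxE.
by rewrite rowE delta_regular -rowE !mxE.
Qed.

Lemma restr_inj (s : 'S_n) : injectiveb [ffun x : 'I_k => s (w x)].
Proof.
apply/injectiveP => x y; rewrite !ffunE => /perm_inj /(congr1 val) /=.
exact: val_inj.
Qed.

Definition restr (s : 'S_n) : kperm k n :=
  exist (fun f : {ffun 'I_k -> 'I_n} => injectiveb f) _ (restr_inj s).

Lemma restrE s x : val (restr s) x = s (w x).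
Proof. by rewrite ffunE. Qed.

Lemma kperm_eqP (f g : kperm k n) : (forall x, val f x = val g x) <-> f = g.
Proof. by split=> [E | -> //]; apply/val_inj/ffunP. Qed.

Lemma restr_onto (f : kperm k n) : exists s, restr s = f.
Proof.
have f_inj := injectiveP _ (valP f).
(* Fill the remaining positions with the remaining values, in order. *)
pose s := [seq val f x | x <- enum 'I_k] ++ [seq y <- enum 'I_n | y \notin codom (val f)].
have us : uniq s.
  rewrite cat_uniq map_inj_uniq // enum_uniq filter_uniq ?enum_uniq // andbT /=.
  by apply/hasPn => y; rewrite mem_filter => /andP[].
have ss : size s = n.
  have : perm_eq s (enum 'I_n).
    apply: uniq_perm (enum_uniq _) _ => // y.
    by rewrite mem_enum mem_cat mem_filter mem_enum andbT orbN.
  by move/perm_size; rewrite size_enum_ord.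
pose g (x : 'I_n) := nth x s x.
have g_inj : injective g.
  move=> x y; rewrite /g (set_nth_default x y) ?ss // => /eqP.
  by rewrite nth_uniq ?ss // => /eqP/val_inj.
exists (perm g_inj); apply/kperm_eqP => x; rewrite restrE permE /g.
rewrite nth_cat size_map size_enum_ord /= ltn_ord (nth_map x) ?size_enum_ord //=.
by rewrite nth_ord_enum.
Qed.

(** The inverse turns the action on the positions of a k-permutation into right
    multiplication. *)
Definition lift (v : 'rV[algC]_K) : 'rV[algC]_N :=
  \row_j v 0 (enum_rank (restr (enum_val j)^-1%g)).

Lemma coord_lift v g : coord (lift v) g = v 0 (enum_rank (restr g^-1%g)).
Proof. by rewrite /coord mxE gring_indexK ?inE. Qed.

Lemma lift_inj : injective lift.
Proof.
move=> v v' E; apply/rowP => i; have [s Es] := restr_onto (enum_val i).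
have := congr1 (fun u => coord u s^-1%g) E.
by rewrite /= !coord_lift invgK Es enum_valK.
Qed.

Lemma liftZ a v : lift (a *: v) = a *: lift v.
Proof. by apply/rowP=> j; rewrite !mxE. Qed.

Local Notation D := (below n k).

Lemma restr_mul (h s : 'S_n) : perm_on (~: D) h -> restr (h * s)%g = restr s.
Proof.
move=> Dh; apply/kperm_eqP => x; rewrite !restrE permM (out_perm Dh) //.
by rewrite in_setC negbK inE; apply: (ltn_ord x).
Qed.

Lemma lift_fixed v h : perm_on (~: D) h -> lift v *m aG h = lift v.
Proof.
move=> Dh; apply: coord_inj => g.
by rewrite coord_regular !coord_lift invMg invgK restr_mul.
Qed.

(** Two permutations with the same restriction to the first k points differ by a
    permutation of the last n - k points. *)
Lemma fixed_lift (u : 'rV_N) :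
  (forall h, perm_on (~: D) h -> u *m aG h = u) -> exists v, u = lift v.
Proof.
move=> u_fix; pose sec f := odflt 1%g [pick s | restr s == f].
have secK f : restr (sec f) = f.
  rewrite /sec; case: pickP => [s /eqP //|no_s].
  by have [s /eqP] := restr_onto f; rewrite no_s.
exists (\row_i coord u (sec (enum_val i))^-1%g); apply: coord_inj => g.
rewrite coord_lift mxE enum_rankK; set s := sec _.
have Es : restr s = restr g^-1%g by rewrite secK.
have Dh : perm_on (~: D) (s * g)%g.
  apply/subsetP => x; rewrite !inE; apply: contra => lt_x; apply/eqP.
  have := congr1 (fun f : kperm k n => val f (Ordinal lt_x)) Es.
  rewrite /= !ffunE permM => E; rewrite -[RHS](permKV g); congr (g _).
  rewrite (_ : w (Ordinal lt_x) = x) in E; last exact: val_inj.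
  exact: E.
by rewrite -{1}(u_fix _ Dh) coord_regular invMg mulKVg.
Qed.

Definition cross_sum : 'M[algC]_N :=
  \sum_(x in D) \sum_(y in ~: D) aG (tperm x y).

Lemma tperm_sum_cross :
  tperm_sum aG setT = tperm_sum aG D + tperm_sum aG (~: D) + 2%:R *: cross_sum.
Proof.
have split_sum (V : nmodType) (F : 'I_n -> V) :
    \sum_(x in setT) F x = \sum_(x in D) F x + \sum_(x in ~: D) F x.
  by rewrite (bigID (mem D)) /=; congr (_ + _); apply: eq_bigl => x; rewrite !inE.
rewrite /tperm_sum split_sum.
under eq_bigr => x _ do rewrite split_sum.
under [X in _ + X = _]eq_bigr => x _ do rewrite split_sum.
rewrite !big_split /= [X in _ + (X + _)]exchange_big /=.
rewrite scaler_nat mulr2n -!addrA; congr (_ + _).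
rewrite [RHS]addrCA /cross_sum; congr (_ + _); rewrite addrC; congr (_ + _).
by apply: eq_bigr => x _; apply: eq_bigr => y _; rewrite tpermC.
Qed.

Lemma fixed_tperm_sum (u : 'rV_N) :
    (forall h, perm_on (~: D) h -> u *m aG h = u) ->
  u *m tperm_sum aG (~: D) = ((n - k) ^ 2)%:R *: u.
Proof.
move=> u_fix; have card_D : #|~: D| = (n - k)%N.
  rewrite cardsCs setCK card_ord; congr (_ - _)%N.
  rewrite -[RHS]card_ord -(card_codom (f := w)); last first.
    by move=> x y /(congr1 val) E; apply: val_inj.
  apply: eq_card => x; rewrite inE; apply/idP/codomP => [lt_x|[y ->]].
    by exists (Ordinal lt_x); apply: val_inj.
  exact: (ltn_ord y).
rewrite /tperm_sum mulmx_sumr (eq_bigr (fun=> (n - k)%:R *: u)) => [|x Dx].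
  by rewrite sumr_const card_D -scaler_nat scalerA -natrM.
rewrite mulmx_sumr (eq_bigr (fun=> u)) => [|y Dy].
  by rewrite sumr_const card_D -scaler_nat.
rewrite u_fix //; apply: (subset_trans (tperm_on x y)); apply/subsetP=> z.
by rewrite in_set2 => /orP[] /eqP->.
Qed.

Hypothesis k_gt0 : (0 < k)%N.

Let notDw (y : 'I_n) (z : 'I_k) : y \in ~: D -> y != w z.
Proof. by rewrite !inE; apply: contraNneq => ->; rewrite /= ltn_ord. Qed.

Lemma restr_tperm_neq (s : 'S_n) (a z : 'I_k) y : y \in ~: D -> z != a ->
  val (restr (tperm (w a) y * s)%g) z = s (w z).
Proof.
move=> Dy neq_za; rewrite restrE permM tpermD //; last exact: notDw.
by apply: contra neq_za => /eqP/(congr1 val) E; apply/eqP/val_inj.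
Qed.

Lemma restr_tperm_eq (s : 'S_n) (a : 'I_k) y :
  val (restr (tperm (w a) y * s)%g) a = s y.
Proof. by rewrite restrE permM tpermL. Qed.

Let DP x : reflect (exists a, x = w a) (x \in D).
Proof.
rewrite inE; apply: (iffP idP) => [lt_x|[a ->]]; last exact: (ltn_ord a).
by exists (Ordinal lt_x); apply: val_inj.
Qed.

(** A neighbour of a k-permutation changes one value, at a say; the new value is
    not taken at another of the first k positions, so it is s y with y >= k. *)
Lemma adjacent_restr (s : 'S_n) :
  [set restr (tperm p.1 p.2 * s)%g | p in setX D (~: D)]
  = [set f | arrangement_adj f (restr s)].
Proof.
apply/setP => f; rewrite inE; apply/imsetP/eqP => [[[x y]]|adj].
  rewrite in_setX /= => /andP[/DP[a ->] Dy] ->.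
  rewrite (_ : [set i | _] = [set~ a]) ?cardsC1 ?card_ord ?subn1 //.
  apply/setP => z; rewrite in_set in_setC1; have [->|neq_za] := eqVneq z a.
    rewrite restr_tperm_eq restrE; apply/negbTE.
    by rewrite (inj_eq perm_inj) notDw.
  by rewrite restr_tperm_neq // restrE eqxx.
set A := [set i | _] in adj.
have /cards1P[a EA] : #|~: A| == 1%N.
  by have := cardsC A; rewrite adj card_ord; lia.
have Af z : (val f z == s (w z)) = (z != a).
  by rewrite -restrE -in_setC1 -EA setCK inE.
have fa := Af a; rewrite eqxx /= in fa.
pose y := s^-1%g (val f a); have sy : s y = val f a by rewrite permKV.
have Dy : y \in ~: D.
  rewrite in_setC; apply/negP => /DP[b Ey]; have [Eb|neq_ba] := eqVneq b a.
    by case/negP: (negbT fa); rewrite -Eb -Ey sy Eb.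
  have : val f b == s (w b) by rewrite Af.
  rewrite -Ey sy => /eqP E; have Eb := injectiveP _ (valP f) _ _ E.
  by rewrite Eb eqxx in neq_ba.
exists (w a, y); first by rewrite in_setX Dy andbT; apply/DP; exists a.
apply/kperm_eqP => z /=; have [->|neq_za] := eqVneq z a.
  by rewrite restr_tperm_eq.
by rewrite restr_tperm_neq //; apply/eqP; rewrite Af.
Qed.

Lemma restr_tperm_inj (s : 'S_n) :
  {in setX D (~: D) &, injective (fun p => restr (tperm p.1 p.2 * s)%g)}.
Proof.
move=> [x y] [x' y']; rewrite !in_setX /=.
move=> /andP[/DP[a ->] Dy] /andP[/DP[a' ->] Dy'] E.
have Ea := congr1 (fun f : kperm k n => val f a) E.
rewrite /= restr_tperm_eq in Ea; have [Eaa|neq_a] := eqVneq a a'.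
  by rewrite Eaa restr_tperm_eq in Ea *; rewrite (perm_inj Ea).
rewrite restr_tperm_neq // in Ea; have := notDw a Dy.
by rewrite (perm_inj Ea) eqxx.
Qed.

Lemma lift_adjacency v :
  lift v *m cross_sum = lift (v *m arrangement_mx n k).
Proof.
apply: coord_inj => g; rewrite coord_lift; set s := g^-1%g.
transitivity (\sum_(f | arrangement_adj f (restr s)) v 0 (enum_rank f)); last first.
  rewrite mxE (reindex enum_rank) /=; last exact/onW_bij/enum_rank_bij.
  rewrite big_mkcond; apply: eq_bigr => f _; rewrite mxE !enum_rankK.
  by case: ifP; rewrite ?mulr1 ?mulr0.
transitivity (\sum_(f in [set f | arrangement_adj f (restr s)]) v 0 (enum_rank f)).
  rewrite -adjacent_restr big_imset; last exact: restr_tperm_inj.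
  rewrite (eq_bigl (fun p => (p.1 \in D) && (p.2 \in ~: D))) => [|p]; last first.
    by case: p => x y; rewrite in_setX.
  rewrite -(pair_big (mem D) (mem (~: D))
    (fun x y => v 0 (enum_rank (restr (tperm x y * s)%g)))) /=.
  rewrite /coord mulmx_sumr summxE; apply: eq_bigr => x _.
  rewrite mulmx_sumr summxE; apply: eq_bigr => y _.
  by rewrite -/(coord _ _) coord_regular coord_lift invMg invgK.
by apply: eq_bigl => f; rewrite inE.
Qed.

End Arrangement.

(* 'S_1 has no transposition: for k = 1 the element tau_k is arbitrary, its    *)
(* term being killed by the factor 'C(1, 2) = 0.                               *)
Theorem theorem3p5 (n k : nat) (k_gt0 : (0 < k)%N) (lt_kn : (k < n)%N)
    (tau_n : 'S_n) (tau_k : 'S_k)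
    (tau_nP : is_transposition tau_n)
    (tau_kP : (1 < k)%N -> is_transposition tau_k)
    (a : algC) :
  eigenvalue (arrangement_mx n k) a <->
  exists lam mu : seq nat,
    [/\ is_partition k lam, is_partition n mu, prec lam mu &
        a = 'C(n, 2)%:R * (specht_char n mu tau_n / specht_char n mu 1%g)
          - 'C(k, 2)%:R * (specht_char k lam tau_k / specht_char k lam 1%g)
          - 'C(n - k, 2)%:R].
Proof.
have le_kn := ltnW lt_kn; pose aG := regular_repr algC (Symg n).
(* Doubling leaves only the scalars of the sums of transpositions. *)
have pair_a lam mu : is_partition k lam -> is_partition n mu ->
    a = 'C(n, 2)%:R * (specht_char n mu tau_n / specht_char n mu 1%g)
      - 'C(k, 2)%:R * (specht_char k lam tau_k / specht_char k lam 1%g)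
      - 'C(n - k, 2)%:R
    <-> ((n - k) ^ 2)%:R + a *+ 2 = pair_sum mu - pair_sum lam.
  move=> lam_part mu_part.
  rewrite (specht_pair_sum lam_part tau_kP) (specht_pair_sum (tau := tau_n) mu_part) //.
  set x := _ * _; set y := _ * _.
  have Ek : (n - k)%:R = n%:R - k%:R :> algC by rewrite natrB.
  have Ebin := binomial_half (n - k)%N; rewrite Ek in Ebin.
  move: Ebin; move: ('C(n - k, 2)%:R) (((n - k) ^ 2)%:R) => c d Ebin.
  split=> [->|E]; first by rewrite !mulrnBl Ebin; ring.
  apply: (mulIf (x := 2%:R)); first by rewrite pnatr_eq0.
  rewrite !mulr_natr !mulrnBl Ebin; apply: (addrI d); rewrite E; ring.
split=> [/eigenvalueP[v vA v0]|[lam [mu [lam_part mu_part lam_mu]]]].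
  pose u := lift le_kn v.
  have u0 : u != 0.
    apply: contraNneq v0 => E; apply/eqP.
    apply: (@lift_inj n k le_kn); rewrite -/u E.
    by apply/rowP => j; rewrite !mxE.
  have u_fix h : perm_on (~: below n k) h -> u *m aG h = u by apply: lift_fixed.
  have u_eig : u *m (tperm_sum aG setT - tperm_sum aG (below n k))
      = (((n - k) ^ 2)%:R + a *+ 2) *: u.
    rewrite (tperm_sum_cross n k) -addrA addrC addrA subrK mulmxDr -scalemxAr.
    rewrite (fixed_tperm_sum le_kn u_fix) lift_adjacency // vA liftZ.
    by rewrite scalerA -scalerDl mulr_natl addrC.
  have u_adj (x y : 'I_n) :
      (k <= x)%N -> y = x.+1 :> nat -> u *m aG (tperm x y) = u.
    move=> le_kx xy; apply: u_fix; apply: (subset_trans (tperm_on x y)).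
    apply/subsetP=> z; rewrite in_set2 => /orP[] /eqP->; rewrite !inE -leqNgt //.
    by rewrite xy leqW.
  have [lam [mu [lam_part mu_part lam_mu E]]] := fixed_eigenvalue u0 le_kn u_adj u_eig.
  by exists lam, mu; split=> //; apply/pair_a.
move/(pair_a _ _ lam_part mu_part) => Ea.
have [/eqP sz_lam /eqP sz_mu] : sumn lam == k /\ sumn mu == n.
  by case/and3P: lam_part; case/and3P: mu_part.
have [pos labT labD] := prec_labelling le_kn sz_lam sz_mu lam_mu.
pose u := strip_vector (below n k) pos.
have pos_inj : injective pos.
  by move=> x y; apply: (labelling_inj labT); rewrite inE.
have boxP z : z \in ~: below n k ->
    in_diagram mu (pos z) /\ ~~ in_diagram lam (pos z).
  move=> Dz; split; first by apply: (labelling_mem labT); rewrite inE.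
  apply: contraL Dz => /(labelling_onto labD)[x Dx /pos_inj <-].
  by rewrite inE negbK.
have u0 : u != 0.
  apply: strip_vector_neq0 => // x y Dx Dy Ec.
  have [mx lx] := boxP _ Dx; have [my ly] := boxP _ Dy.
  apply: pos_inj; rewrite [LHS]surjective_pairing [RHS]surjective_pairing Ec.
  congr pair; apply: (lam_mu.2 _ _ (pos x).2); first by rewrite -surjective_pairing.
  - by rewrite -surjective_pairing.
  - by rewrite Ec -surjective_pairing.
  - by rewrite Ec -surjective_pairing.
have u_fix h : perm_on (~: below n k) h -> u *m aG h = u.
  by apply: strip_vector_fixed.
have [v Ev] := fixed_lift le_kn u_fix.
have um := strip_vector_tperm_all (below n k) mu_part labT.
have ul := strip_vector_tperm_sub lam_part labD.
have uc : u *m cross_sum n k = a *: u.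
  have two0 : 2%:R != 0 :> algC by rewrite pnatr_eq0.
  apply: (scalerI two0); rewrite scalemxAr scalerA mulr_natl.
  have := tperm_sum_cross n k => /(congr1 (mulmx u)).
  rewrite um !mulmxDr ul fixed_tperm_sum // => /eqP.
  rewrite -scalerDl addrC -subr_eq -scalerBl => /eqP <-; congr (_ *: _).
  by rewrite opprD addrA -Ea addrC addKr.
apply/eigenvalueP; exists v; last first.
  by apply: contraNneq u0 => v0; rewrite Ev v0; apply/eqP/rowP => j; rewrite !mxE.
by apply: (@lift_inj n k le_kn); rewrite -lift_adjacency // -Ev uc Ev liftZ.
Qed.
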